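(* Let $(V,\omega)$ be a symplectic vector space of dimension $2n$. If $n\ge3$, the space of torsion-like tensors $\wedge^2V^*\otimes V^*$ has the decomposition in irreducible $\mathrm{Sp}(V)$-submodules $$\wedge^2V^*\otimes V^*=\tilde{\mathcal T}_1(V)+\tilde{\mathcal T}_2(V)+\tilde{\mathcal T}_3(V)+\tilde{\mathcal T}_4(V),$$ where $$\tilde{\mathcal T}_1(V)=\{\tilde T\in\wedge^2V^*\otimes V^*:\tilde T_{XYZ}=2\omega_{XY}\omega_{ZU}+\omega_{XZ}\omega_{YU}-\omega_{YZ}\omega_{XU},\ U\in V\},$$ $$\tilde{\mathcal T}_2(V)=\{\tilde T\in\wedge^2V^*\otimes V^*:\tilde T_{XYZ}+\tilde T_{YZX}+\tilde T_{ZXY}=0,\ \mathrm t_{12}(\tilde T)=0\},$$ $$\tilde{\mathcal T}_3(V)=\{\tilde T\in\wedge^2V^*\otimes V^*:\tilde T_{XYZ}=\omega_{XY}\omega_{UZ}+\omega_{YZ}\omega_{UX}+\omega_{ZX}\omega_{UY},\ U\in V\},$$ $$\tilde{\mathcal T}_4(V)=\{\tilde T\in\wedge^2V^*\otimes V^*:\tilde T_{XYZ}=-\tilde T_{XZY},\ \mathrm t_{12}(\tilde T)=0\},$$ and $$\mathrm t_{12}(\tilde T)(Z)=\sum_{i=1}^n\tilde T_{e_ie_{i+n}Z}$$ for a symplectic basis $\{e_1,\dots,e_n,e_{n+1},\dots,e_{2n}\}$ of $V$. If $n=2$, then $\wedge^2V^*\otimes V^*=\tilde{\mathcal T}_1(V)+\tilde{\mathcal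 T}_2(V)+\tilde{\mathcal T}_3(V)$. If $n=1$, then $\wedge^2V^*\otimes V^*=\tilde{\mathcal T}_1(V)$. In addition, $$\dim\tilde{\mathcal T}_1(V)=\dim\tilde{\mathcal T}_3(V)=2n,\qquad\dim\tilde{\mathcal T}_2(V)=\tfrac83(n^3-n),\qquad\dim\tilde{\mathcal T}_4(V)=\tfrac23n(2n^2-3n-2).$$
   Context: $\omega_{XY}=\omega(X,Y)$. A tensor $\tilde T\in\wedge^2V^*\otimes V^*$ is a trilinear form $\tilde T_{XYZ}=\tilde T(X,Y,Z)$ on $V$ with $\tilde T_{XYZ}=-\tilde T_{YXZ}$. Conditions on $\tilde T_{XYZ}$ are to hold for all $X,Y,Z\in V$; in $\tilde{\mathcal T}_1(V)$ and $\tilde{\mathcal T}_3(V)$ the vector $U$ ranges over $V$ and parametrizes the elements of the submodule. A symplectic basis satisfies $\omega(e_i,e_{j+n})=\delta_{ij}$, $\omega(e_i,e_j)=\omega(e_{i+n},e_{j+n})=0$ for $1\le i,j\le n$. $\mathrm{Sp}(V)=\mathrm{Sp}(V,\omega)$ is the group of linear symplectomorphisms, acting naturally on tensors.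
   Formalization: The formulas for the dimensions of T̃_3(V) and T̃_4(V) are stated only for n ≥ 2, since for n = 1 both spaces are 0 (alternating 3-forms on a plane) while the formulas give 2 and −2. *)

(* Defs.v *)
From HB Require Import structures.
From mathcomp Require Import all_boot all_order all_algebra.
From mathcomp Require Import boolp classical_sets reals.
From mathcomp Require Import ring.

Set Implicit Arguments.
Unset Strict Implicit.
Unset Printing Implicit Defensive.

Import GRing.Theory Num.Theory.
Local Open Scope ring_scope.

(* [vspace_of P] is the subspace {v | P v}.  It is only meaningful when P is   *)
(* closed under linear combinations (see [vspace_ofP]); otherwise it is 0.    *)
Definition vspace_of (K : fieldType) (W : vectType K) (P : W -> Prop) :
    {vspace W} :=
  xget 0%VS [set U : {vspace W} | forall v, v \in U <-> P v]%classic.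

Lemma vspace_ofP (K : fieldType) (W : vectType K) (P : W -> Prop) :
  P 0 -> (forall a u v, P u -> P v -> P (a *: u + v)) ->
  forall v, v \in vspace_of P <-> P v.
Proof.
move=> P0 Plin.
suff [U UP] : exists U : {vspace W}, forall v, v \in U <-> P v.
  by rewrite /vspace_of; case: xgetP => [V _ //|/(_ U)].
pose Q k := `[< exists2 U : {vspace W},
                 (forall v, v \in U -> P v) & \dim U = k >].
have exQ : exists k, Q k.
  exists 0%N; apply/asboolP; exists 0%VS; last by rewrite dimv0.
  by move=> v; rewrite memv0 => /eqP ->.
have leQ k : Q k -> (k <= \dim {:W})%N.
  by move=> /asboolP[U _ <-]; apply/dimvS/subvf.
have [k /asboolP[U UP dU] maxk] := ex_maxnP exQ leQ.
exists U => v; split=> [/UP //|Pv].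
have UvP w : w \in (<[v]> + U)%VS -> P w.
  by move=> /memv_addP[_ /vlineP[a ->] [u Uu ->]]; apply: Plin => //; apply: UP.
have: Q (\dim (<[v]> + U)%VS) by apply/asboolP; exists (<[v]> + U)%VS.
move=> /maxk; rewrite -dU => le_d.
have /eqP-> : U == (<[v]> + U)%VS by rewrite eqEdim addvSr.
by apply: (subvP (addvSl _ _)); apply: memv_line.
Qed.

Lemma linfun_fun (K : fieldType) (aT rT : vectType K) (f : aT -> rT) :
  linear f -> forall x, linfun f x = f x.
Proof.
move=> lin_f x.
pose h := GRing.isLinear.Build K aT rT *:%R f lin_f.
pose F : {linear aT -> rT} := HB.pack f h.
exact: (lfunE F).
Qed.

(* V^* (x) V^* (x) V^* as curried trilinear forms: the value of T at X, Y, Z  *)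
(* is [T X Y Z].                                                              *)
Definition tensor3 (R : realType) (V : vectType R) : Type :=
  'Hom(V, 'Hom(V, 'Hom(V, R^o))).
HB.instance Definition _ (R : realType) (V : vectType R) :=
  Vector.on (tensor3 V).

Section Action.
Variables (R : realType) (V : vectType R).
Implicit Types (T : tensor3 V) (g : 'End(V)).

(* Natural action of a linear automorphism on covariant tensors; see          *)
(* [tensor3_actE].                                                            *)
Definition tensor3_act g T : tensor3 V :=
  linfun (fun X : V => linfun (fun Y : V => linfun (fun Z : V =>
    T ((g^-1)%VF X) ((g^-1)%VF Y) ((g^-1)%VF Z) : R^o))).

Lemma tensor3_actE g T X Y Z :
  tensor3_act g T X Y Z = T ((g^-1)%VF X) ((g^-1)%VF Y) ((g^-1)%VF Z).
Proof.
have lZ x y : linear (fun z => T ((g^-1)%VF x) ((g^-1)%VF y) ((g^-1)%VF z) : R^o).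
  by move=> a u v; rewrite !linearP.
have lY x : linear (fun y => linfun (fun z =>
    T ((g^-1)%VF x) ((g^-1)%VF y) ((g^-1)%VF z) : R^o)).
  move=> a u v; apply/lfunP=> z; rewrite add_lfunE scale_lfunE !(linfun_fun (lZ _ _)).
  by rewrite !linearP !add_lfunE !scale_lfunE.
have lX : linear (fun x => linfun (fun y => linfun (fun z =>
    T ((g^-1)%VF x) ((g^-1)%VF y) ((g^-1)%VF z) : R^o))).
  move=> a u v; apply/lfunP=> y; apply/lfunP=> z.
  rewrite !(add_lfunE, scale_lfunE) !(linfun_fun (lY _)) !(linfun_fun (lZ _ _)).
  by rewrite !linearP !(add_lfunE, scale_lfunE).
by rewrite /tensor3_act (linfun_fun lX) (linfun_fun (lY _)) (linfun_fun (lZ _ _)).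
Qed.

End Action.

Section Symplectic.
Variables (R : realType) (V : vectType R) (omega : {skew_symmetric V}).
Implicit Types (T : tensor3 V) (g : 'End(V)) (W U : {vspace tensor3 V}).

Definition symplectomorphism g : Prop :=
  lker g == 0%VS /\ isometry omega omega g.

Definition Sp_submodule W : Prop :=
  forall g, symplectomorphism g ->
    forall T, T \in W -> tensor3_act g T \in W.

Definition Sp_irreducible W : Prop :=
  [/\ Sp_submodule W, W != 0%VS
    & forall U, Sp_submodule U -> (U <= W)%VS -> U = 0%VS \/ U = W].

(* With 0-based indices: e`_i is e_(i+1) and e`_(i + n) is e_(i+1+n).         *)
Definition symplectic_basis n (e : (2 * n).-tuple V) : Prop :=
  basis_of fullv e /\
  forall i j : 'I_n,
    [/\ omega e`_i e`_(j + n)%N = (i == j)%:R,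
        omega e`_i e`_j = 0 & omega e`_(i + n)%N e`_(j + n)%N = 0].

Definition t12 n (e : (2 * n).-tuple V) T (Z : V) : R :=
  \sum_(i < n) T e`_i e`_(i + n)%N Z.

Definition torsion_like T : Prop := forall X Y Z, T X Y Z = - T Y X Z.

Definition torsion_tensors : {vspace tensor3 V} := vspace_of torsion_like.

Definition calT1 : {vspace tensor3 V} := vspace_of (fun T =>
  torsion_like T /\
  exists U : V, forall X Y Z,
    T X Y Z = 2 * omega X Y * omega Z U
              + omega X Z * omega Y U - omega Y Z * omega X U).

Definition calT2 n (e : (2 * n).-tuple V) : {vspace tensor3 V} :=
  vspace_of (fun T =>
    [/\ torsion_like T,
        forall X Y Z, T X Y Z + T Y Z X + T Z X Y = 0
      & forall Z, t12 e T Z = 0]).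

Definition calT3 : {vspace tensor3 V} := vspace_of (fun T =>
  torsion_like T /\
  exists U : V, forall X Y Z,
    T X Y Z = omega X Y * omega U Z
              + omega Y Z * omega U X + omega Z X * omega U Y).

Definition calT4 n (e : (2 * n).-tuple V) : {vspace tensor3 V} :=
  vspace_of (fun T =>
    [/\ torsion_like T,
        forall X Y Z, T X Y Z = - T X Z Y
      & forall Z, t12 e T Z = 0]).

(* The conditions above are closed under linear combinations, so the          *)
(* comprehensions are not the default value of [vspace_of].                   *)

Lemma tensor3_0E X Y Z : (0 : tensor3 V) X Y Z = 0 :> R.
Proof. by rewrite !zero_lfunE. Qed.

Lemma torsion_like0 : torsion_like 0.
Proof. by move=> X Y Z; rewrite !tensor3_0E oppr0. Qed.

Lemma tensor3_PE (a : R) (S T : tensor3 V) X Y Z :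
  (a *: S + T) X Y Z = a * S X Y Z + T X Y Z :> R.
Proof. by rewrite !(add_lfunE, scale_lfunE). Qed.

Lemma torsion_likeD (a : R) S T :
  torsion_like S -> torsion_like T -> torsion_like (a *: S + T).
Proof.
by move=> hS hT X Y Z; rewrite [LHS]tensor3_PE hS hT tensor3_PE mulrN opprD.
Qed.

Lemma t12_lin n (e : (2 * n).-tuple V) (a : R) (S T : tensor3 V) Z :
  t12 e (a *: S + T) Z = a * t12 e S Z + t12 e T Z.
Proof.
by rewrite /t12 mulr_sumr -big_split; apply: eq_bigr => i _; exact: tensor3_PE.
Qed.

Lemma mem_torsion_tensors T : T \in torsion_tensors <-> torsion_like T.
Proof. by move: T; apply: vspace_ofP; [exact: torsion_like0 | exact: torsion_likeD]. Qed.

Lemma mem_calT1 T : T \in calT1 <->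
  torsion_like T /\
  exists U : V, forall X Y Z,
    T X Y Z = 2 * omega X Y * omega Z U
              + omega X Z * omega Y U - omega Y Z * omega X U.
Proof.
move: T; apply: vspace_ofP.
  split; first exact: torsion_like0.
  exists 0 => X Y Z; rewrite !tensor3_0E.
  by rewrite !linear0r; ring.
move=> a S T [hS [u hu]] [hT [v hv]]; split; first exact: torsion_likeD.
exists (a *: u + v) => X Y Z; rewrite [LHS]tensor3_PE hu hv.
by rewrite !linearPr /=; ring.
Qed.

Lemma mem_calT2 n (e : (2 * n).-tuple V) T : T \in calT2 e <->
  [/\ torsion_like T,
      forall X Y Z, T X Y Z + T Y Z X + T Z X Y = 0
    & forall Z, t12 e T Z = 0].
Proof.
move: T; apply: vspace_ofP.
  split=> [|X Y Z|Z]; first exact: torsion_like0; last first.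
    by rewrite /t12 big1 // => i _; rewrite !tensor3_0E.
  by rewrite !tensor3_0E !addr0.
move=> a S T [hS cS tS] [hT cT tT]; split=> [|X Y Z|Z].
- exact: torsion_likeD.
- have -> : (a *: S + T) X Y Z + (a *: S + T) Y Z X + (a *: S + T) Z X Y =
    a * (S X Y Z + S Y Z X + S Z X Y) + (T X Y Z + T Y Z X + T Z X Y) :> R.
    by rewrite !tensor3_PE; ring.
  by rewrite cS cT mulr0 addr0.
- by rewrite t12_lin tS tT mulr0 addr0.
Qed.

Lemma mem_calT3 T : T \in calT3 <->
  torsion_like T /\
  exists U : V, forall X Y Z,
    T X Y Z = omega X Y * omega U Z
              + omega Y Z * omega U X + omega Z X * omega U Y.
Proof.
move: T; apply: vspace_ofP.
  split; first exact: torsion_like0.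
  exists 0 => X Y Z; rewrite !tensor3_0E.
  by rewrite !linear0l; ring.
move=> a S T [hS [u hu]] [hT [v hv]]; split; first exact: torsion_likeD.
exists (a *: u + v) => X Y Z; rewrite [LHS]tensor3_PE hu hv.
by rewrite !linearPl /=; ring.
Qed.

Lemma mem_calT4 n (e : (2 * n).-tuple V) T : T \in calT4 e <->
  [/\ torsion_like T,
      forall X Y Z, T X Y Z = - T X Z Y
    & forall Z, t12 e T Z = 0].
Proof.
move: T; apply: vspace_ofP.
  split=> [|X Y Z|Z]; first exact: torsion_like0; last first.
    by rewrite /t12 big1 // => i _; rewrite !tensor3_0E.
  by rewrite !tensor3_0E oppr0.
move=> a S T [hS cS tS] [hT cT tT]; split=> [|X Y Z|Z].
- exact: torsion_likeD.
- by rewrite [LHS]tensor3_PE cS cT tensor3_PE mulrN opprD.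
- by rewrite t12_lin tS tT mulr0 addr0.
Qed.

(* Symplectic bases exist, so quantifying over them is not vacuous. *)
Lemma exists_symplectic_basis n :
  is_psymplectic omega -> \dim {:V} = (2 * n)%N ->
  exists e : (2 * n).-tuple V, symplectic_basis e.
Proof.
move=> [ndg _ _] dimV.
have skew x y : omega x y = - omega y x by rewrite hermC expr1 mulN1r.
have skew0 x : omega x x = 0.
  by have /eqP := skew x x; rewrite -addr_eq0 -mulr2n mulrn_eq0 => /eqP.
pose rel k (p q : nat -> V) := forall i j, (i < k)%N -> (j < k)%N ->
  [/\ omega (p i) (q j) = (i == j)%:R, omega (p i) (p j) = 0
    & omega (q i) (q j) = 0].
have ex k : (k <= n)%N -> exists p q, rel k p q.
  elim: k => [_|k IHk lt_kn]; first by exists (fun=> 0), (fun=> 0).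
  have [p [q pq]] := IHk (ltnW lt_kn).
  pose s x := \sum_(i < k) (omega x (q i) *: p i - omega x (p i) *: q i).
  have sq x j : (j < k)%N -> omega (x - s x) (q j) = 0.
    move=> ltj; rewrite linearBl /= linear_sumlz /= (bigD1 (Ordinal ltj)) //=.
    rewrite big1 => [|i /negPf nij].
      have [pqj _ qj] := pq j j ltj ltj.
      by rewrite linearBl !linearZl_LR /= pqj qj eqxx /=; ring.
    have [pqj _ qj] := pq i j (ltn_ord i) ltj.
    rewrite linearBl !linearZl_LR /= pqj qj.
    by rewrite (_ : (i == j :> nat) = false) //=; ring.
  have sp x j : (j < k)%N -> omega (x - s x) (p j) = 0.
    move=> ltj; rewrite linearBl /= linear_sumlz /= (bigD1 (Ordinal ltj)) //=.
    rewrite big1 => [|i /negPf nij].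
      have [pqj pj _] := pq j j ltj ltj.
      by rewrite linearBl !linearZl_LR /= (skew (q j)) pqj pj eqxx /=; ring.
    have [pqj pj _] := pq j i ltj (ltn_ord i).
    have [_ pi _] := pq i j (ltn_ord i) ltj.
    rewrite linearBl !linearZl_LR /= (skew (q i)) pqj pi eq_sym.
    by rewrite (_ : (i == j :> nat) = false) //=; ring.
  pose S := <<mkseq p k ++ mkseq q k>>%VS.
  have [x xS] : exists x, x \notin S.
    apply: contrapT => /forallNP nS.
    have /dimvS : (fullv <= S)%VS.
      by apply/subvP => y _; apply: contrapT => /negP; apply: nS.
    rewrite dimV leqNgt (leq_ltn_trans (dim_span _)) //.
    by rewrite size_cat !size_mkseq addnn -mul2n ltn_pmul2l.
  have s_in y : s y \in S.
    apply: memv_suml => i _; apply: memvB; apply: memvZ; apply: memv_span.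
      by rewrite mem_cat map_f ?mem_iota /=.
    by rewrite mem_cat orbC map_f ?mem_iota /=.
  pose u := x - s x.
  have : u \notin orthov omega fullv.
    rewrite (eqP ndg) memv0 subr_eq0.
    by apply: contraNneq xS => ->.
  move=> /mem_orthovPn[w _ uw].
  pose v := (omega u w)^-1 *: (w - s w).
  have uv : omega u v = 1.
    rewrite linearZr /= linearBr /= linear_sumr big1 => [|i _].
      by rewrite subr0 mulVf.
    by rewrite linearBr !linearZr /= sq // sp // !mulr0 subr0.
  have vq j : (j < k)%N -> omega v (q j) = 0.
    by move=> ltj; rewrite linearZl_LR /= sq // mulr0.
  have vp j : (j < k)%N -> omega v (p j) = 0.
    by move=> ltj; rewrite linearZl_LR /= sp // mulr0.
  exists (fun i => if i == k then u else p i), (fun i => if i == k then v else q i).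
  move=> i j; rewrite !ltnS.
  case: (eqVneq i k) => [->|nik]; case: (eqVneq j k) => [->|njk] lti ltj /=.
  - by rewrite uv !skew0.
  - have ltjk : (j < k)%N by rewrite ltn_neqAle njk.
    by rewrite sq // sp // vq //.
  - have ltik : (i < k)%N by rewrite ltn_neqAle nik.
    by rewrite (skew _ v) vp // (skew _ u) sp // (skew _ v) vq // (negPf nik) oppr0.
  - by apply: pq; rewrite ltn_neqAle ?nik ?njk.
have [p [q pq]] := ex n (leqnn n).
pose es := mkseq p n ++ mkseq q n.
have es_size : size es == (2 * n)%N by rewrite size_cat !size_mkseq mul2n addnn.
have esp i : (i < n)%N -> es`_i = p i.
  by move=> lti; rewrite nth_cat size_mkseq lti nth_mkseq.
have esq i : (i < n)%N -> es`_(i + n) = q i.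
  move=> lti; rewrite nth_cat size_mkseq ltnNge leq_addl /= addnK.
  by rewrite nth_mkseq.
exists (Tuple es_size); split; last first.
  move=> i j; rewrite /= (esp i) // (esp j) // (esq i) // (esq j) //.
  by have := pq i j (ltn_ord i) (ltn_ord j).
rewrite basisEfree subvf dimV /= (eqP es_size) leqnn !andbT.
pose d j := if (j < n)%N then es`_(j + n) else - es`_(j - n).
have esd i j : (i < 2 * n)%N -> (j < 2 * n)%N -> omega es`_i (d j) = (i == j)%:R.
  have half l : (l < 2 * n)%N -> (n <= l)%N -> (l - n < n)%N.
    by move=> l2 ln; rewrite ltn_subLR // addnn -mul2n.
  move=> lti ltj; rewrite /d; case: (ltnP j n) => jn; case: (ltnP i n) => i_n.
  - by rewrite (esp i) // (esq j) //; have [] := pq i j.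
  - have ih := half i lti i_n; rewrite -{1}(subnK i_n) (esq _ ih) (esq _ jn).
    have [_ _ ->] := pq (i - n)%N j ih jn.
    by rewrite gtn_eqF // (leq_trans jn).
  - have jh := half j ltj jn; rewrite linearNr /= (esp _ i_n) (esp _ jh).
    have [_ -> _] := pq i (j - n)%N i_n jh.
    by rewrite oppr0 ltn_eqF // (leq_trans i_n).
  - have jh := half j ltj jn; have ih := half i lti i_n.
    rewrite linearNr /= -{1}(subnK i_n) (esq _ ih) (esp _ jh) skew opprK.
    have [-> _ _] := pq (j - n)%N (i - n)%N jh ih.
    by rewrite eqn_sub2rE // eq_sym.
have -> : es = tval (Tuple es_size) by [].
apply/freeP => c c0 j.
have: omega (\sum_(i < 2 * n) c i *: es`_i) (d j) = 0 by rewrite c0 linear0l.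
rewrite linear_sumlz (bigD1 j) //= big1 => [|i nij].
  by rewrite linearZl_LR /= esd // eqxx mulr1 addr0.
rewrite linearZl_LR /= esd // (_ : (i == j :> nat) = false) ?mulr0 //.
exact: negPf.
Qed.

End Symplectic.

(* Main.v *)
Require Import Defs.
From HB Require Import structures.
From mathcomp Require Import all_boot all_order all_algebra.
From mathcomp Require Import reals.
From mathcomp Require boolp.
From mathcomp Require Import ring lra.

(* Torsion-like tensors split into alternating forms and tensors with vanishing
   cyclic sum, and the trace t12 separates each of these into a copy of V
   (T3, resp. T1) and its kernel (T4, resp. T2); dimensions follow by counting
   coordinates.  Transvections act transitively enough on V to make T1 and T3
   irreducible.  For W = T2 or T4, fix isotropic basis vectors u, v, w (with
   w = u for T2) and let H in W be the Young symmetrization of the covectors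
   omega(-,u), omega(-,v), omega(-,w).
   (i) If T in W vanishes on the Sp-orbit of (u, v, w), then T = 0.
   (ii) If T(u, v, w) <> 0, then iterated differences of T along the
   transvections of u, v, w give a nonzero multiple of H, so H lies in the
   submodule generated by T.
   (iii) The pairing induced by omega sends (g H, T) to a multiple of
   T(gu, gv, gw).
   A nonzero submodule U of W contains H by (i) and (ii); if U were smaller
   than W, some nonzero T in W would pair to 0 with U, contradicting (iii)
   and (i). *)

Set Implicit Arguments.
Unset Strict Implicit.
Unset Printing Implicit Defensive.

Import GRing.Theory Num.Theory.
Local Open Scope ring_scope.

(** * Dimension counts *)

Section Coordinates.
Variables (K : fieldType) (W : vectType K) (D : finType) (c : D -> W -> K).
Hypothesis c_lin : forall d a u v, c d (a *: u + v) = a * c d u + c d v.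
Implicit Type U : {vspace W}.

Let F : 'Hom(W, {ffun D -> K^o}) := linfun (fun u => [ffun d => c d u : K^o]).

Let FE u d : F u d = c d u.
Proof.
rewrite /F linfun_fun ?ffunE // => a x y.
by apply/ffunP => i; rewrite !ffunE c_lin.
Qed.

Let dimF : \dim {: {ffun D -> K^o} } = #|D|.
Proof. by rewrite dimvf /dim /= muln1. Qed.

Let F0 u : F u = 0 <-> forall d, c d u = 0.
Proof.
split=> [Fu d|cu]; first by rewrite -FE Fu ffunE.
by apply/ffunP => d; rewrite FE cu ffunE.
Qed.

(** The coordinate map on [U] has rank at most [#|D|], so rank-nullity leaves a nonzero kernel. This
    supplies the tensor orthogonal to a proper submodule. *)
Lemma exists_common_zero U : (#|D| < \dim U)%N ->
  exists u, [/\ u \in U, u != 0 & forall d, c d u = 0].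
Proof.
move=> ltDU; have kerP : (U :&: lker F)%VS != 0%VS.
  rewrite -dimv_eq0 -lt0n -(ltn_add2r (\dim (F @: U))) limg_ker_dim add0n.
  by rewrite (leq_ltn_trans _ ltDU) // -dimF dimvS // subvf.
have := memv_pick (U :&: lker F); rewrite memv_cap memv_ker => /andP[uU /eqP/F0 cu].
by exists (vpick (U :&: lker F)); split=> //; rewrite vpick0.
Qed.

Lemma dim_of_coordinates U :
    (forall u, u \in U -> (forall d, c d u = 0) -> u = 0) ->
    (forall y : D -> K, exists2 u, u \in U & forall d, c d u = y d) ->
  \dim U = #|D|.
Proof.
move=> c_inj c_surj; rewrite -dimF -(limg_dim_eq (f := F)); last first.
  apply/eqP; rewrite -subv0; apply/subvP => u; rewrite memv_cap memv_ker.
  by move=> /andP[uU /eqP/F0 cu]; rewrite (c_inj u) ?mem0v.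
congr (\dim _); apply/eqP; rewrite eqEsubv subvf; apply/subvP => y _.
have [u uU cu] := c_surj y.
by apply/memv_imgP; exists u => //; apply/ffunP => d; rewrite FE cu.
Qed.

End Coordinates.

(** * Calculus of trilinear forms *)

Section Tensors.
Variables (R : realType) (V : vectType R).
Implicit Types (S T : tensor3 V) (x y z u v w : V) (a : R).

Lemma t3_add1 T x x' y z : T (x + x') y z = T x y z + T x' y z :> R.
Proof. by rewrite linearD !add_lfunE. Qed.
Lemma t3_add2 T x y y' z : T x (y + y') z = T x y z + T x y' z :> R.
Proof. by rewrite linearD !add_lfunE. Qed.
Lemma t3_add3 T x y z z' : T x y (z + z') = T x y z + T x y z' :> R.
Proof. by rewrite linearD. Qed.
Lemma t3_scale1 T a x y z : T (a *: x) y z = a * T x y z :> R.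
Proof. by rewrite linearZ !scale_lfunE. Qed.
Lemma t3_scale2 T a x y z : T x (a *: y) z = a * T x y z :> R.
Proof. by rewrite linearZ !scale_lfunE. Qed.
Lemma t3_scale3 T a x y z : T x y (a *: z) = a * T x y z :> R.
Proof. by rewrite linearZ. Qed.
Lemma t3_opp1 T x y z : T (- x) y z = - T x y z :> R.
Proof. by rewrite linearN !opp_lfunE. Qed.
Lemma t3_opp2 T x y z : T x (- y) z = - T x y z :> R.
Proof. by rewrite linearN !opp_lfunE. Qed.
Lemma t3_opp3 T x y z : T x y (- z) = - T x y z :> R.
Proof. by rewrite linearN. Qed.

Definition t3E := (t3_add1, t3_add2, t3_add3, t3_scale1, t3_scale2, t3_scale3,
  t3_opp1, t3_opp2, t3_opp3).

Lemma t3_zero1 T y z : T 0 y z = 0 :> R.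
Proof. by rewrite linear0 !zero_lfunE. Qed.
Lemma t3_zero3 T x y : T x y 0 = 0 :> R.
Proof. by rewrite linear0. Qed.

Lemma t3_addE S T x y z : (S + T) x y z = S x y z + T x y z :> R.
Proof. by rewrite !add_lfunE. Qed.
Lemma t3_scaleE a T x y z : (a *: T) x y z = a * T x y z :> R.
Proof. by rewrite !scale_lfunE. Qed.
Lemma t3_oppE T x y z : (- T) x y z = - T x y z :> R.
Proof. by rewrite !opp_lfunE. Qed.

Definition t3opE := (t3_addE, t3_scaleE, t3_oppE).

Lemma t3P S T : (forall x y z, S x y z = T x y z :> R) -> S = T.
Proof. by move=> ST; do 3![apply/lfunP=> ?]; apply: ST. Qed.

Lemma t3_sum1 (I : finType) (F : I -> V) T y z :
  T (\sum_i F i) y z = \sum_i T (F i) y z :> R.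
Proof. by rewrite linear_sum !sum_lfunE. Qed.
Lemma t3_sum2 (I : finType) (F : I -> V) T x z :
  T x (\sum_i F i) z = \sum_i T x (F i) z :> R.
Proof. by rewrite linear_sum !sum_lfunE. Qed.
Lemma t3_sum3 (I : finType) (F : I -> V) T x y :
  T x y (\sum_i F i) = \sum_i T x y (F i) :> R.
Proof. by rewrite linear_sum. Qed.

Definition trilinear (f : V -> V -> V -> R) : Prop :=
  [/\ forall a x x' y z, f (a *: x + x') y z = a * f x y z + f x' y z,
      forall a x y y' z, f x (a *: y + y') z = a * f x y z + f x y' z
    & forall a x y z z', f x y (a *: z + z') = a * f x y z + f x y z'].

(* [locked] stops unification from unfolding the nested [linfun]s. *)
Definition tensor3_of (f : V -> V -> V -> R) : tensor3 V :=
  locked (linfun (fun x => linfun (fun y => linfun (fun z => f x y z : R^o)))).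

Lemma tensor3_ofE f x y z : trilinear f -> tensor3_of f x y z = f x y z :> R.
Proof.
case=> l1 l2 l3.
have lZ u v : linear (fun z => f u v z : R^o) by move=> a w w'; apply: l3.
have lY u : linear (fun v => linfun (fun z => f u v z : R^o)).
  move=> a v v'; apply/lfunP=> w; rewrite add_lfunE scale_lfunE.
  by rewrite !(linfun_fun (lZ _ _)) l2.
have lX : linear (fun u => linfun (fun v => linfun (fun z => f u v z : R^o))).
  move=> a u u'; apply/lfunP=> v; rewrite add_lfunE scale_lfunE.
  rewrite !(linfun_fun (lY _)); apply/lfunP=> w; rewrite add_lfunE scale_lfunE.
  by rewrite !(linfun_fun (lZ _ _)) l1.
by rewrite /tensor3_of -lock (linfun_fun lX) (linfun_fun (lY _)) (linfun_fun (lZ _ _)).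
Qed.

Lemma trilinear_t3 T : trilinear (fun x y z => T x y z).
Proof. by split=> *; rewrite !t3E. Qed.

Lemma trilinear_swap f : trilinear f -> trilinear (fun x y z => f y x z).
Proof. by case=> l1 l2 l3; split=> *; rewrite ?l1 ?l2 ?l3. Qed.

End Tensors.

(** * Dimensions of the torsion-like tensors and of the alternating forms *)

Section Dimensions.
Variables (R : realType) (V : vectType R).
Let N := \dim {:V}.
Let b := vbasis (fullv : {vspace V}).
Implicit Types (S T : tensor3 V).

Let basis_b : basis_of fullv b. Proof. exact: vbasisP. Qed.

Let bexp (x : V) : x = \sum_i coord b i x *: b`_i.
Proof. by apply: coord_vbasis; apply: memvf. Qed.

Let coordb (i j : 'I_N) : coord b i b`_j = (i == j)%:R.
Proof. by rewrite coord_free ?(basis_free basis_b) // eq_sym. Qed.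

Lemma t3_basis_ext S T :
  (forall i j k : 'I_N, S b`_i b`_j b`_k = T b`_i b`_j b`_k :> R) -> S = T.
Proof.
move=> ST; apply: t3P => x y z.
rewrite (bexp x) !t3_sum1; apply: eq_bigr => i _; rewrite !t3_scale1; congr (_ * _).
rewrite (bexp y) !t3_sum2; apply: eq_bigr => j _; rewrite !t3_scale2; congr (_ * _).
by rewrite (bexp z) !t3_sum3; apply: eq_bigr => k _; rewrite !t3_scale3 ST.
Qed.

Definition tensor3_coef (f : 'I_N -> 'I_N -> 'I_N -> R) : tensor3 V :=
  tensor3_of (fun x y z =>
    \sum_i \sum_j \sum_k f i j k * coord b i x * coord b j y * coord b k z).

Lemma tensor3_coefE f (i j k : 'I_N) : tensor3_coef f b`_i b`_j b`_k = f i j k :> R.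
Proof.
rewrite tensor3_ofE; last first.
  split=> a * /=; rewrite mulr_sumr -big_split; apply: eq_bigr => i' _;
  rewrite mulr_sumr -big_split; apply: eq_bigr => j' _;
  rewrite mulr_sumr -big_split; apply: eq_bigr => k' _; rewrite linearP /=; ring.
rewrite (bigD1 i) //= [X in _ + X]big1 ?addr0 => [|i' /negPf ni].
  rewrite (bigD1 j) //= [X in _ + X]big1 ?addr0 => [|j' /negPf nj].
    rewrite (bigD1 k) //= [X in _ + X]big1 ?addr0 => [|k' /negPf nk].
      by rewrite !coordb !eqxx !mulr1.
    by rewrite !coordb nk mulr0.
  by rewrite big1 // => k' _; rewrite !coordb nj mulr0 mul0r.
by rewrite big1 // => j' _; rewrite big1 // => k' _; rewrite !coordb ni mulr0 !mul0r.
Qed.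

(** The tensor [T] and the negative of its transpose agree on basis triples, hence everywhere. *)
Lemma torsion_like_basis T :
  (forall i j k : 'I_N, T b`_i b`_j b`_k = - T b`_j b`_i b`_k :> R) -> torsion_like T.
Proof.
have swE x y z : tensor3_of (fun x y z => T y x z) x y z = T y x z :> R.
  by rewrite tensor3_ofE //; apply/trilinear_swap/trilinear_t3.
move=> anti; have eqT : T = - tensor3_of (fun x y z => T y x z).
  by apply: t3_basis_ext => i j k; rewrite t3_oppE swE anti.
by move=> x y z; rewrite {1}eqT t3_oppE swE.
Qed.

Lemma antisym23_basis T :
  (forall i j k : 'I_N, T b`_i b`_j b`_k = - T b`_i b`_k b`_j :> R) ->
  forall x y z, T x y z = - T x z y.
Proof.
have swE x y z : tensor3_of (fun x y z => T x z y) x y z = T x z y :> R.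
  by rewrite tensor3_ofE //; split=> *; rewrite !t3E.
move=> anti; have eqT : T = - tensor3_of (fun x y z => T x z y).
  by apply: t3_basis_ext => i j k; rewrite t3_oppE swE anti.
by move=> x y z; rewrite {1}eqT t3_oppE swE.
Qed.

Definition increasing m := {t : m.-tuple 'I_N | sorted ltn (map val t)}.

Lemma card_increasing m : #|{: increasing m}| = 'C(N, m).
Proof. by rewrite card_sig -card_ltn_sorted_tuples cardsE. Qed.

Lemma dim_torsion_tensors : \dim (torsion_tensors V) = (N * 'C(N, 2))%N.
Proof.
pose c (d : 'I_N * increasing 2) (T : tensor3 V) : R :=
  T b`_(tnth (val d.2) ord0) b`_(tnth (val d.2) (lift ord0 ord0)) b`_d.1.
have -> : (N * 'C(N, 2))%N = #|{: 'I_N * increasing 2}|.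
  by rewrite card_prod card_ord card_increasing.
apply: (@dim_of_coordinates _ _ _ c) => [d a S T|T /mem_torsion_tensors antiT c0|y].
- by rewrite /c !t3opE.
- have lt0 (i j k : 'I_N) : (i < j)%N -> T b`_i b`_j b`_k = 0 :> R.
    move=> ltij; have st : sorted ltn (map val [tuple i; j]) by rewrite /= ltij.
    exact: (c0 (k, exist _ [tuple i; j] st)).
  apply: t3_basis_ext => i j k; rewrite tensor3_0E.
  case: (ltngtP i j) => [/lt0//|ltji|/val_inj->].
    by rewrite antiT lt0 // oppr0.
  by have := antiT b`_j b`_j b`_k; lra.
(* The data are extended by zero, so only one of the two antisymmetrized terms survives at an
   increasing pair. *)
- pose f (i j k : 'I_N) : R :=
    if insub [tuple i; j] is Some t then y (k, t : increasing 2) else 0.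
  have f0 (i j k : 'I_N) : ~~ (i < j)%N -> f i j k = 0.
    by move=> nij; rewrite /f insubF //= andbT; apply/negbTE.
  exists (tensor3_coef (fun i j k => f i j k - f j i k)).
    apply/mem_torsion_tensors/torsion_like_basis => i j k.
    by rewrite !tensor3_coefE opprB.
  case=> k [t st]; rewrite /c /=.
  case/tupleP: t st => i t; case/tupleP: t => j t; rewrite (tuple0 t) => st.
  have ltij : (i < j)%N by move: (st); rewrite /= andbT.
  rewrite !(tnth_nth i) /= tensor3_coefE (f0 j i) ?subr0; last by rewrite -leqNgt ltnW.
  by rewrite /f (insubT (fun t : 2.-tuple 'I_N => sorted ltn (map val t)) st).
Qed.

Definition lambda3 : {vspace tensor3 V} :=
  vspace_of (fun T => torsion_like T /\ forall x y z, T x y z = - T x z y).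

Lemma mem_lambda3 T : T \in lambda3 <->
  torsion_like T /\ forall x y z, T x y z = - T x z y.
Proof.
move: T; apply: vspace_ofP; first by split=> x y z; rewrite !tensor3_0E oppr0.
move=> a S T [hS aS] [hT aT]; split; first exact: torsion_likeD.
by move=> x y z; rewrite !tensor3_PE aS aT; ring.
Qed.

Lemma dim_lambda3 : \dim lambda3 = 'C(N, 3).
Proof.
pose c (d : increasing 3) (T : tensor3 V) : R :=
  T b`_(tnth (val d) ord0) b`_(tnth (val d) (lift ord0 ord0)) b`_(tnth (val d) ord_max).
rewrite -card_increasing.
apply: (@dim_of_coordinates _ _ _ c) => [d a S T|T /mem_lambda3[antiT asymT] c0|y].
- by rewrite /c !t3opE.
- have lt0 (i j k : 'I_N) : (i < j)%N -> (j < k)%N -> T b`_i b`_j b`_k = 0 :> R.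
    move=> ltij ltjk; have st : sorted ltn (map val [tuple i; j; k]).
      by rewrite /= ltij ltjk.
    exact: (c0 (exist _ [tuple i; j; k] st)).
  have eq12 x y : T x x y = 0 :> R by have := antiT x x y; lra.
  have eq23 x y : T x y y = 0 :> R by have := asymT x y y; lra.
  have eq13 x y : T x y x = 0 :> R by rewrite asymT eq12 oppr0.
  apply: t3_basis_ext => i j k; rewrite tensor3_0E.
  wlog ltij : i j / (i < j)%N => [hw|].
    case: (ltngtP i j) => [/hw//|/hw eq0|/val_inj->]; last exact: eq12.
    by rewrite antiT eq0 oppr0.
  case: (ltngtP j k) => [ltjk|ltkj|/val_inj<-]; [exact: lt0| |exact: eq23].
  rewrite asymT; case: (ltngtP i k) => [ltik|ltki|/val_inj->].
  - by rewrite lt0 ?oppr0.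
  - by rewrite antiT lt0 ?opprK.
  - by rewrite eq12 oppr0.
- pose f (i j k : 'I_N) : R :=
    if insub [tuple i; j; k] is Some t then y (t : increasing 3) else 0.
  have f0 (i j k : 'I_N) : ~~ ((i < j) && (j < k))%N -> f i j k = 0.
    by move=> nij; rewrite /f insubF //= andbT; apply/negbTE.
  (* Signed sum over the six permutations; at an increasing triple every term but the first is
     zero. *)
  exists (tensor3_coef (fun i j k =>
      f i j k - f j i k + f j k i - f k j i + f k i j - f i k j)).
    apply/mem_lambda3; split.
      by apply: torsion_like_basis => i j k; rewrite !tensor3_coefE; ring.
    by apply: antisym23_basis => i j k; rewrite !tensor3_coefE; ring.
  case=> t st; rewrite /c /=.
  case/tupleP: t st => i t; case/tupleP: t => j t; case/tupleP: t => k t.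
  rewrite (tuple0 t) => st.
  have /andP[ltij ltjk] : ((i < j) && (j < k))%N by move: (st); rewrite /= andbT.
  have ltik := ltn_trans ltij ltjk.
  rewrite !(tnth_nth i) /= tensor3_coefE.
  rewrite (f0 j i) ?(f0 j k i) ?(f0 k j i) ?(f0 k i j) ?(f0 i k j) ?negb_and -?leqNgt;
    rewrite ?(ltnW ltij) ?(ltnW ltjk) ?(ltnW ltik) ?orbT //.
  by rewrite !addr0 !subr0 /f (insubT (fun t : 3.-tuple 'I_N => sorted ltn (map val t)) st).
Qed.

End Dimensions.

(** * Symplectic transvections *)

Section SymplecticForm.
Variables (R : realType) (V : vectType R) (omega : {skew_symmetric V}).
Implicit Types (S T : tensor3 V) (x y z u v w : V) (a : R) (g h : 'End(V)).

Lemma omegaC x y : omega x y = - omega y x.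
Proof. by rewrite hermC expr1 mulN1r. Qed.
Lemma omegaxx x : omega x x = 0.
Proof. by have := omegaC x x; lra. Qed.
Lemma omega_addl x x' y : omega (x + x') y = omega x y + omega x' y.
Proof. exact: linearDl. Qed.
Lemma omega_addr x y y' : omega x (y + y') = omega x y + omega x y'.
Proof. exact: linearDr. Qed.
Lemma omega_scalel a x y : omega (a *: x) y = a * omega x y.
Proof. exact: linearZl_LR. Qed.
Lemma omega_scaler a x y : omega x (a *: y) = a * omega x y.
Proof. exact: linearZr. Qed.
Lemma omega_oppl x y : omega (- x) y = - omega x y.
Proof. exact: linearNl. Qed.
Lemma omega_oppr x y : omega x (- y) = - omega x y.
Proof. exact: linearNr. Qed.
Lemma omega_suml (I : finType) (F : I -> V) y :
  omega (\sum_i F i) y = \sum_i omega (F i) y.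
Proof. exact: linear_sumlz. Qed.
Lemma omega_sumr (I : finType) (F : I -> V) x :
  omega x (\sum_i F i) = \sum_i omega x (F i).
Proof. exact: linear_sumr. Qed.

Definition omegaE := (omega_addl, omega_addr, omega_scalel, omega_scaler,
  omega_oppl, omega_oppr).

(** Pointwise form of nondegeneracy; a symplectic basis provides it through [symp_nondeg]. *)
Definition omega_nondeg : Prop := forall x, (forall y, omega x y = 0) -> x = 0.

Definition transv a v : 'End(V) := linfun (fun x => x + (a * omega x v) *: v).

Lemma transvE a v x : transv a v x = x + (a * omega x v) *: v.
Proof.
apply: linfun_fun => b y y'; rewrite !omegaE scalerDr addrACA scalerA -scalerDl.
by congr (_ + _ *: _); ring.
Qed.

Hypothesis nondeg : omega_nondeg.

(** Injectivity is automatic: a vector in the kernel of an isometry is orthogonal to everything. *)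
Lemma isometry_sympl g : isometry omega omega g -> symplectomorphism omega g.
Proof.
move=> iso_g; split=> //; apply/lker0P => x y gxy; apply/subr0_eq/nondeg => z.
have -> : omega (x - y) z = omega (g (x - y)) (g z) by rewrite iso_g.
by rewrite [g (x - y)]linearB /= gxy subrr linear0l.
Qed.

Lemma transv_sympl a v : symplectomorphism omega (transv a v).
Proof.
apply: isometry_sympl => x y; rewrite !transvE !omegaE omegaxx (omegaC v y).
by ring.
Qed.

Lemma sympl_id : symplectomorphism omega \1%VF.
Proof. by apply: isometry_sympl => x y; rewrite !id_lfunE. Qed.

Lemma sympl_comp g h : symplectomorphism omega g -> symplectomorphism omega h ->
  symplectomorphism omega (g \o h)%VF.
Proof.
move=> [_ iso_g] [_ iso_h]; apply: isometry_sympl => x y.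
by rewrite !comp_lfunE iso_g iso_h.
Qed.

Lemma sympl_inv g : symplectomorphism omega g -> symplectomorphism omega g^-1%VF.
Proof.
move=> [ker_g iso_g]; apply: isometry_sympl => x y.
by rewrite -iso_g !lker0_lfunVK.
Qed.

Lemma sympl_eq_inv g x y : symplectomorphism omega g ->
  omega ((g^-1)%VF x) y = omega x (g y).
Proof. by move=> [ker_g iso_g]; rewrite -iso_g lker0_lfunVK. Qed.

Lemma act_transvE a v T x y z :
  tensor3_act (transv a v) T x y z =
  T (x - (a * omega x v) *: v) (y - (a * omega y v) *: v) (z - (a * omega z v) *: v) :> R.
Proof.
have [ker_t _] := transv_sympl a v; rewrite tensor3_actE.
have inv_t t : (transv a v)^-1%VF t = t - (a * omega t v) *: v.
  apply: (lker0P ker_t); rewrite lker0_lfunVK // transvE !omegaE omegaxx mulr0 subr0.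
  by rewrite subrK.
by rewrite !inv_t.
Qed.

(** [tensor3_act] substitutes the inverse, and the inverse of [transv (- a) v] is [transv a v]. This
    form, free of inverses, serves to take differences inside a submodule. *)
Lemma exists_transv_pullback (U : {vspace tensor3 V}) T a v :
    Sp_submodule omega U -> T \in U ->
  exists2 S, S \in U & forall x y z, S x y z =
    T (x + (a * omega x v) *: v) (y + (a * omega y v) *: v) (z + (a * omega z v) *: v) :> R.
Proof.
move=> subU TU; exists (tensor3_act (transv (- a) v) T).
  by apply: subU TU; apply: transv_sympl.
by move=> x y z; rewrite act_transvE !mulNr !scaleNr !opprK.
Qed.

Lemma exists_dual x : x != 0 -> exists y, omega x y = 1.
Proof.
move=> x0; have [y xy] : exists y, omega x y != 0.
  apply: boolp.contrapT => /boolp.forallNP all0; case/eqP: x0; apply: nondeg => y.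
  by apply/eqP; apply: boolp.contrapT => /negP; apply: all0.
by exists ((omega x y)^-1 *: y); rewrite !omegaE mulVf.
Qed.

Lemma exists_dual_orth x v : (forall a, x != a *: v) ->
  exists w, omega x w = 1 /\ omega v w = 0.
Proof.
move=> xNv; have [v0|v0] := eqVneq v 0.
  have x0 : x != 0 by rewrite -(scale0r v).
  by have [w xw] := exists_dual x0; exists w; rewrite v0 linear0l.
have [u vu] := exists_dual v0.
(* Project [x] along [v] to make it orthogonal to [u], take a dual [y] of the result, then correct
   [y] by a multiple of [u] to make it orthogonal to [v]. *)
have : x - omega x u *: v != 0 by rewrite subr_eq0.
move=> /exists_dual[y]; rewrite !omegaE => xy.
exists (y - omega v y *: u); rewrite !omegaE vu; split; last by ring.
by rewrite -xy; ring.
Qed.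

End SymplecticForm.
Arguments omegaC {R V omega} x y.

Lemma linear_at0 (K : nzRingType) (U W : lmodType K) (F : U -> W) : linear F -> F 0 = 0.
Proof. by move=> F_lin; have := F_lin (-1) 0 0; rewrite scaler0 addr0 scaleN1r addNr. Qed.

(** * Irreducibility criteria *)

Section Irreducibility.
Variables (R : realType) (V : vectType R) (omega : {skew_symmetric V}).
Implicit Types (S T : tensor3 V) (x y z u v w : V) (a : R) (g h : 'End(V)).
Hypothesis nondeg : omega_nondeg omega.

(** Such a [W] is a copy of [V]. The transvection along [w] moves [F u] by [omega u w] times [F w],
    so a submodule containing [F u] contains [F w] for every [w] not orthogonal to [u]; a vector
    orthogonal to [u] is a difference of two such vectors. *)
Lemma irreducible_vector_image (F : V -> tensor3 V) (W : {vspace tensor3 V}) :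
    linear F -> (forall u, F u = 0 -> u = 0) ->
    (forall g u, symplectomorphism omega g -> tensor3_act g (F u) = F (g u)) ->
    (forall T, T \in W <-> exists u, T = F u) -> (exists u, u != 0) ->
  Sp_irreducible omega W.
Proof.
move=> F_lin F_inj F_act WF [u0 u0_neq0].
have F_add u v a : F (u + a *: v) = F u + a *: F v.
  by rewrite addrC F_lin addrC.
split=> [g sg T /WF[u ->]||U subU leUW]; first by apply/WF; exists (g u); apply: F_act.
  apply: contraNneq u0_neq0 => W0; apply/eqP/F_inj/eqP.
  by rewrite -memv0 -W0; apply/WF; exists u0.
have [->|U0] := eqVneq U 0%VS; [by left | right].
apply/eqP; rewrite eqEsubv leUW; apply/subvP => _ /WF[v ->].
have UT := memv_pick U; have /WF[u eqT] := subvP leUW _ UT.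
have u_neq0 : u != 0.
  apply: contraNneq U0 => u0'; rewrite -vpick0 eqT u0'.
  by rewrite linear_at0.
have mem_nonorth w : omega u w != 0 -> F w \in U.
  move=> uw; have := subU _ (transv_sympl nondeg 1 w) _ UT.
  rewrite eqT F_act ?transvE ?mul1r; last exact: transv_sympl.
  rewrite F_add -eqT => /(memvB)/(_ UT); rewrite addrC addKr.
  by move=> /(memvZ (omega u w)^-1); rewrite scalerA mulVf // scale1r.
have [uv|uv] := eqVneq (omega u v) 0; last exact: mem_nonorth.
have [w uw] := exists_dual nondeg u_neq0.
rewrite -(addrK w v) -[- w]scaleN1r F_add scaleN1r.
by apply: memvB; apply: mem_nonorth; rewrite ?omegaE ?uv ?add0r uw oner_neq0.
Qed.

(** * The pairing of tensors induced by the symplectic form *)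

Section Pairing.
Variables (I : finType) (eps del : I -> V).
Hypothesis expand : forall x, x = \sum_i omega x (del i) *: eps i.

Definition rank1 u v w : tensor3 V :=
  tensor3_of (fun x y z => omega x u * omega y v * omega z w).

Lemma rank1E u v w x y z : rank1 u v w x y z = omega x u * omega y v * omega z w :> R.
Proof. by rewrite tensor3_ofE //; split=> *; rewrite !omegaE; ring. Qed.

Lemma act_rank1 g u v w : symplectomorphism omega g ->
  tensor3_act g (rank1 u v w) = rank1 (g u) (g v) (g w).
Proof. by move=> sg; apply: t3P => x y z; rewrite tensor3_actE !rank1E !sympl_eq_inv. Qed.

Lemma act_lin g a S T :
  tensor3_act g (a *: S + T) = a *: tensor3_act g S + tensor3_act g T.
Proof.
by apply: t3P => x y z; rewrite tensor3_actE [RHS]tensor3_PE !tensor3_actE -tensor3_PE.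
Qed.

(** Contraction of all three slots against dual bases, that is, the bilinear form that [omega]
    induces on the third tensor power. *)
Definition pairing S T : R :=
  \sum_i \sum_j \sum_k S (del i) (del j) (del k) * T (eps i) (eps j) (eps k).

Lemma pairing_linl a S S' T : pairing (a *: S + S') T = a * pairing S T + pairing S' T.
Proof.
rewrite /pairing mulr_sumr -big_split; apply: eq_bigr => i _.
rewrite mulr_sumr -big_split; apply: eq_bigr => j _.
by rewrite mulr_sumr -big_split; apply: eq_bigr => k _; rewrite !t3opE /=; ring.
Qed.

Lemma pairing_linr a S T T' : pairing S (a *: T + T') = a * pairing S T + pairing S T'.
Proof.
rewrite /pairing mulr_sumr -big_split; apply: eq_bigr => i _.
rewrite mulr_sumr -big_split; apply: eq_bigr => j _.
by rewrite mulr_sumr -big_split; apply: eq_bigr => k _; rewrite !t3opE /=; ring.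
Qed.

(** Expanding [u], [v], [w] in [eps] leaves three factors such as [omega (del i) u], each the
    negative of a coordinate; hence the sign. *)
Lemma pairing_rank1 u v w T : pairing (rank1 u v w) T = - T u v w.
Proof.
rewrite [in RHS](expand u) t3_sum1 -sumrN; apply: eq_bigr => i _; rewrite t3_scale1.
rewrite -mulrN [in RHS](expand v) t3_sum2 -sumrN mulr_sumr; apply: eq_bigr => j _.
rewrite t3_scale2 [in RHS](expand w) t3_sum3 mulr_sumr -sumrN mulr_sumr.
apply: eq_bigr => k _; rewrite t3_scale3 rank1E.
by rewrite (omegaC _ u) (omegaC _ v) (omegaC _ w); ring.
Qed.

(** The last three hypotheses are the facts (iii), (ii) and (i) of the overview, in this order, for
    the generator [H] and the test triple [(u, v, w)]. *)
Lemma irreducible_criterion (W : {vspace tensor3 V}) (H : tensor3 V) u v w a :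
    a != 0 -> Sp_submodule omega W -> W != 0%VS ->
    (forall g T, symplectomorphism omega g -> T \in W ->
      pairing (tensor3_act g H) T = a * T (g u) (g v) (g w)) ->
    (forall (U : {vspace tensor3 V}) T, Sp_submodule omega U -> (U <= W)%VS -> T \in U ->
      T u v w <> 0 -> H \in U) ->
    (forall T, T \in W ->
      (forall g, symplectomorphism omega g -> T (g u) (g v) (g w) = 0) -> T = 0) ->
  Sp_irreducible omega W.
Proof.
move=> a0 subW W0 pairH genH detect; split=> // U subU leUW.
have [->|U0] := eqVneq U 0%VS; [by left | right].
have HU : H \in U.
  have UT := memv_pick U; set T := vpick U in UT.
  (* By detection [T] is nonzero at some [(g u, g v, g w)]; acting by the inverse of [g] moves that
     value to [(u, v, w)]. *)
  have /boolp.existsNP[g /boolp.not_implyP[sg Tg]] :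
      ~ forall g, symplectomorphism omega g -> T (g u) (g v) (g w) = 0.
    by move=> /(detect T (subvP leUW _ UT))/eqP; rewrite vpick0 (negPf U0).
  have sg' := sympl_inv nondeg sg.
  have invK x : ((g^-1)^-1)%VF x = g x.
    have [ker_g _] := sg; have [ker_g' _] := sg'.
    by rewrite -{1}(lker0_lfunK ker_g x) (lker0_lfunK ker_g').
  apply: (genH _ _ subU leUW (subU _ sg' _ UT)).
  by rewrite tensor3_actE !invK.
apply/eqP; rewrite eqEdim leUW leqNgt; apply/negP => ltUW.
(* Orthogonality to a basis of [U] imposes only [\dim U] conditions on the larger space [W]. *)
have [||T [TW T0 T_orth]] := @exists_common_zero _ _ 'I_(\dim U)
  (fun d T => pairing (vbasis U)`_d T) _ W.
- by move=> d b S T; apply: pairing_linr.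
- by rewrite card_ord.
case/eqP: T0; apply: detect => // g sg; apply: (mulfI a0); rewrite mulr0 -pairH //.
have gU := subU _ sg _ HU.
(* By linearity [T] is orthogonal to all of [U], in particular to the image of [H] under [g]. *)
rewrite (coord_vbasis gU); elim/big_ind: _ => [|S1 S2 S10 S20|d _].
- by rewrite /pairing big1 // => i _; rewrite big1 // => j _; rewrite big1 // => k _;
    rewrite tensor3_0E mul0r.
- by rewrite -[S1]scale1r pairing_linl S10 S20 mulr0 addr0.
- rewrite -[_ *: _]addr0 pairing_linl T_orth mulr0 add0r.
  by rewrite /pairing big1 // => i _; rewrite big1 // => j _; rewrite big1 // => k _;
    rewrite tensor3_0E mul0r.
Qed.

End Pairing.
End Irreducibility.

(** * Traces in a symplectic basis *)

Section SymplecticBasis.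
Variables (R : realType) (V : vectType R) (omega : {skew_symmetric V}).
Variables (n : nat) (e : (2 * n).-tuple V).
Hypothesis symp_e : symplectic_basis omega e.
Implicit Types (S T : tensor3 V) (x y z u v w : V) (a : R) (g h : 'End(V)).

(* [del] is the basis dual to [eps]: omega (eps i) (del j) is the Kronecker delta. *)
Definition eps (i : 'I_n * bool) : V := if i.2 then e`_i.1 else e`_(i.1 + n).
Definition del (i : 'I_n * bool) : V := if i.2 then e`_(i.1 + n) else - e`_i.1.

Lemma omega_eps_del i j : omega (eps i) (del j) = (i == j)%:R.
Proof.
case: i j => [i []] [j []]; rewrite /eps /del xpair_eqE /= ?omegaE;
  have [_ ij] := symp_e; have [e1 e2 e3] := ij i j; have [e4 _ _] := ij j i.
- by rewrite e1 andbT.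
- by rewrite e2 andbF oppr0.
- by rewrite e3 andbF.
- by rewrite omegaC e4 opprK eq_sym andbT.
Qed.

Lemma omega_eps_eps i j : i.1 != j.1 -> omega (eps i) (eps j) = 0.
Proof.
case: i j => [i b] [j c] /= ij.
have := omega_eps_del (i, b) (j, ~~ c); rewrite xpair_eqE (negPf ij) /=.
by case: c; rewrite /del /eps /= ?omegaE // => /eqP; rewrite oppr_eq0 => /eqP.
Qed.

Lemma eps_expand x : x = \sum_i omega x (del i) *: eps i.
Proof.
have e_exp (k : 'I_(2 * n)) : e`_k = \sum_i omega e`_k (del i) *: eps i.
  have [j ->] : exists j, e`_k = eps j.
    case: (ltnP k n) => [ltk|lek]; first by exists (Ordinal ltk, true).
    have ltk : (k - n < n)%N by rewrite ltn_subLR // addnn -mul2n.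
    by exists (Ordinal ltk, false); rewrite /eps /= subnK.
  rewrite (bigD1 j) //= omega_eps_del eqxx scale1r big1 ?addr0 // => i.
  by rewrite eq_sym omega_eps_del => /negPf->; rewrite scale0r.
have [basis_e _] := symp_e; rewrite {1 2}(coord_basis basis_e (memvf x)).
under [in RHS]eq_bigr do rewrite omega_suml scaler_suml.
rewrite exchange_big /=; apply: eq_bigr => k _.
rewrite {1}e_exp scaler_sumr; apply: eq_bigr => i _.
by rewrite scalerA omegaE.
Qed.

Lemma t3_eps_ext S T :
  (forall i j k, S (eps i) (eps j) (eps k) = T (eps i) (eps j) (eps k) :> R) -> S = T.
Proof.
move=> ST; apply: t3P => x y z.
rewrite (eps_expand x) !t3_sum1; apply: eq_bigr => i _; rewrite !t3_scale1; congr (_ * _).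
rewrite (eps_expand y) !t3_sum2; apply: eq_bigr => j _; rewrite !t3_scale2; congr (_ * _).
by rewrite (eps_expand z) !t3_sum3; apply: eq_bigr => k _; rewrite !t3_scale3 ST.
Qed.

Lemma symp_nondeg : omega_nondeg omega.
Proof.
by move=> x x0; rewrite (eps_expand x) big1 // => i _; rewrite x0 scale0r.
Qed.

Lemma omega_expand x y : omega x y = \sum_i omega x (del i) * omega (eps i) y.
Proof.
rewrite {1}(eps_expand x) omega_suml; apply: eq_bigr => i _; by rewrite omegaE.
Qed.

Lemma del_expand x : x = \sum_i omega (eps i) x *: del i.
Proof.
apply/subr0_eq/symp_nondeg => y; rewrite omegaC omegaE omega_expand omegaE omega_sumr.
apply/eqP; rewrite oppr_eq0 subr_eq0; apply/eqP; apply: eq_bigr => i _.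
by rewrite omegaE mulrC.
Qed.

Lemma omega_represents (f : V -> R) :
    (forall a x y, f (a *: x + y) = a * f x + f y) ->
  exists u, forall x, f x = omega x u.
Proof.
move=> f_lin; have f0 : f 0 = 0 by have := f_lin 1 0 0; rewrite scale1r addr0; lra.
exists (\sum_i f (eps i) *: del i) => x; rewrite omega_sumr {1}(eps_expand x).
rewrite (big_morph f (id1 := 0) (op1 := +%R)) //; last first.
  by move=> y z; have := f_lin 1 y z; rewrite scale1r mul1r.
apply: eq_bigr => i _; rewrite omegaE.
by have := f_lin (omega x (del i)) (eps i) 0; rewrite !addr0 f0 addr0 mulrC.
Qed.

(** The indices [(i, true)] and [(i, false)] contribute equally by antisymmetry, hence the factor 2.
    The full contraction is the form in which invariance becomes visible. *)
Lemma t12_sum T z : torsion_like T -> 2 * t12 e T z = \sum_i T (eps i) (del i) z.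
Proof.
move=> antiT; rewrite -(pair_bigA _ (fun i b => T (eps (i, b)) (del (i, b)) z : R)) /=.
rewrite /t12 mulr_sumr; apply: eq_bigr => i _; rewrite big_bool /eps /del /=.
by rewrite t3_opp2 (antiT e`_(i + n)); ring.
Qed.

(** The sum of the tensor products of [eps i] and [del i] is Sp-invariant: [inner] is the matrix
    identity saying that [g] carries dual bases to dual bases. *)
Lemma trace_act g T z : symplectomorphism omega g ->
  \sum_i T (g (eps i)) (g (del i)) z = \sum_i T (eps i) (del i) z :> R.
Proof.
move=> sg; have [_ iso_g] := sympl_inv symp_nondeg sg.
have inner j k : \sum_i omega (g (eps i)) (del j) * omega (eps k) (g (del i)) = (k == j)%:R.
  rewrite -(omega_eps_del k j) -(iso_g (eps k)) omega_expand; apply: eq_bigr => i _.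
  by rewrite sympl_eq_inv // mulrC (omegaC _ (g^-1%VF _)) sympl_eq_inv // -omegaC.
transitivity (\sum_i \sum_j \sum_k omega (g (eps i)) (del j) * omega (eps k) (g (del i))
    * T (eps j) (del k) z : R).
  apply: eq_bigr => i _; rewrite {1}(eps_expand (g (eps i))) t3_sum1.
  apply: eq_bigr => j _; rewrite {1}(del_expand (g (del i))) t3_scale1 t3_sum2 mulr_sumr.
  by apply: eq_bigr => k _; rewrite t3_scale2 mulrA.
rewrite exchange_big /=; apply: eq_bigr => j _; rewrite exchange_big /=.
rewrite (bigD1 j) //= [X in _ + X]big1 => [|k nkj]; rewrite -mulr_suml inner.
  by rewrite eqxx mul1r addr0.
by rewrite (negPf nkj) mul0r.
Qed.

Lemma torsion_like_act g T : torsion_like T -> torsion_like (tensor3_act g T).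
Proof. by move=> antiT x y z; rewrite !tensor3_actE. Qed.

Lemma t12_act g T z : symplectomorphism omega g -> torsion_like T ->
  t12 e (tensor3_act g T) z = t12 e T (g^-1%VF z).
Proof.
move=> sg antiT; suff : 2 * t12 e (tensor3_act g T) z = 2 * t12 e T (g^-1%VF z) by lra.
rewrite !t12_sum //; last exact: torsion_like_act.
rewrite -(trace_act T _ (sympl_inv symp_nondeg sg)).
by apply: eq_bigr => i _; rewrite tensor3_actE.
Qed.

Lemma t12_linz T a x y : t12 e T (a *: x + y) = a * t12 e T x + t12 e T y.
Proof.
by rewrite /t12 mulr_sumr -big_split; apply: eq_bigr => i _; rewrite t3E /= t3E.
Qed.

Lemma t12_represents T : exists u, forall z, t12 e T z = omega z u.
Proof. exact/omega_represents/t12_linz. Qed.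

Lemma sum_omega_eps_del (c : R) : \sum_i omega (eps i) (del i) * c = (2 * n)%:R * c.
Proof.
rewrite -mulr_suml (eq_bigr (fun=> 1)) => [|i _]; last by rewrite omega_eps_del eqxx.
by rewrite sumr_const card_prod card_ord card_bool mulnC.
Qed.

Definition tau1 u : tensor3 V := tensor3_of (fun x y z =>
  2 * omega x y * omega z u + omega x z * omega y u - omega y z * omega x u).

Lemma tau1E u x y z : tau1 u x y z =
  2 * omega x y * omega z u + omega x z * omega y u - omega y z * omega x u :> R.
Proof. by rewrite tensor3_ofE //; split=> *; rewrite !omegaE; ring. Qed.

Lemma tau1_torsion u : torsion_like (tau1 u).
Proof. by move=> x y z; rewrite !tau1E (omegaC y x); ring. Qed.

Lemma tau1_linear : linear tau1.
Proof. by move=> a u v; apply: t3P => x y z; rewrite !t3opE !tau1E !omegaE; ring. Qed.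

Lemma mem_calT1_tau1 T : T \in calT1 omega <-> exists u, T = tau1 u.
Proof.
split=> [/mem_calT1[_ [u uT]]|[u ->]].
  by exists u; apply: t3P => x y z; rewrite tau1E uT.
by apply/mem_calT1; split; [exact: tau1_torsion | exists u => x y z; rewrite tau1E].
Qed.

(** In the doubled trace the first term of [tau1] contributes [4 n] and each of the other two
    contributes 1 by [omega_expand], in total [2 (2 n + 1)]. *)
Lemma t12_tau1 u z : t12 e (tau1 u) z = (2 * n).+1%:R * omega z u.
Proof.
suff : 2 * t12 e (tau1 u) z = 2 * ((2 * n).+1%:R * omega z u) by lra.
rewrite t12_sum; last exact: tau1_torsion.
under eq_bigr => i _.
  rewrite tau1E (_ : _ + _ - _ = 2 * (omega (eps i) (del i) * omega z u)
    - omega u (del i) * omega (eps i) z + omega z (del i) * omega (eps i) u); last first.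
    by rewrite (omegaC (del i) u) (omegaC (del i) z); ring.
  over.
rewrite !big_split /= sumrN -mulr_sumr sum_omega_eps_del -!omega_expand (omegaC u).
by rewrite -natr1; ring.
Qed.

(** Asking only that the trace vanish serves twice: for the injectivity of [tau1] and for the
    disjointness of T1 and T2. *)
Lemma tau1_inj u : t12 e (tau1 u) =1 (fun=> 0) -> u = 0.
Proof.
move=> tu; apply: symp_nondeg => z; apply/eqP; rewrite omegaC oppr_eq0.
have := tu z; rewrite t12_tau1 => /eqP; by rewrite mulf_eq0 pnatr_eq0.
Qed.

Lemma act_tau1 g u : symplectomorphism omega g -> tensor3_act g (tau1 u) = tau1 (g u).
Proof.
move=> sg; have [_ iso_g] := sympl_inv symp_nondeg sg.
by apply: t3P => x y z; rewrite tensor3_actE !tau1E !iso_g !sympl_eq_inv.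
Qed.

Definition tau3 u : tensor3 V := tensor3_of (fun x y z =>
  omega x y * omega u z + omega y z * omega u x + omega z x * omega u y).

Lemma tau3E u x y z : tau3 u x y z =
  omega x y * omega u z + omega y z * omega u x + omega z x * omega u y :> R.
Proof. by rewrite tensor3_ofE //; split=> *; rewrite !omegaE; ring. Qed.

Lemma tau3_torsion u : torsion_like (tau3 u).
Proof.
by move=> x y z; rewrite !tau3E (omegaC y x) (omegaC x z) (omegaC z y); ring.
Qed.

Lemma tau3_linear : linear tau3.
Proof. by move=> a u v; apply: t3P => x y z; rewrite !t3opE !tau3E !omegaE; ring. Qed.

Lemma mem_calT3_tau3 T : T \in calT3 omega <-> exists u, T = tau3 u.
Proof.
split=> [/mem_calT3[_ [u uT]]|[u ->]].
  by exists u; apply: t3P => x y z; rewrite tau3E uT.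
by apply/mem_calT3; split; [exact: tau3_torsion | exists u => x y z; rewrite tau3E].
Qed.

(** The contributions to the doubled trace are [2 n], -1 and -1. The factor vanishes for [n = 1],
    which is why splitting [lambda3] into T3 and T4 assumes [1 < n]. *)
Lemma t12_tau3 u z : t12 e (tau3 u) z = (n%:R - 1) * omega u z.
Proof.
suff : 2 * t12 e (tau3 u) z = 2 * ((n%:R - 1) * omega u z) by lra.
rewrite t12_sum; last exact: tau3_torsion.
under eq_bigr => i _.
  rewrite tau3E (_ : _ + _ + _ = omega (eps i) (del i) * omega u z
    + omega z (del i) * omega (eps i) u - omega u (del i) * omega (eps i) z); last first.
    by rewrite (omegaC (del i) z) (omegaC u (eps i)) (omegaC z (eps i)); ring.
  over.
rewrite !big_split /= sumrN sum_omega_eps_del -!omega_expand (omegaC z u).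
by rewrite natrM; ring.
Qed.

Lemma tau3_inj u : (1 < n)%N -> t12 e (tau3 u) =1 (fun=> 0) -> u = 0.
Proof.
move=> n1 tu; apply: symp_nondeg => z.
have := tu z; rewrite t12_tau3 => /eqP; rewrite mulf_eq0 subr_eq0 (eqr_nat R n 1).
by rewrite gtn_eqF //= => /eqP.
Qed.

Lemma act_tau3 g u : symplectomorphism omega g -> tensor3_act g (tau3 u) = tau3 (g u).
Proof.
move=> sg; have [_ iso_g] := sympl_inv symp_nondeg sg.
apply: t3P => x y z; rewrite tensor3_actE !tau3E !iso_g.
by rewrite !(omegaC _ (g^-1%VF _)) !sympl_eq_inv // -!omegaC.
Qed.

Lemma eps_neq0 i : eps i != 0.
Proof.
apply/eqP => i0; have := omega_eps_del i i.
by rewrite i0 linear0l eqxx => /eqP; rewrite eq_sym oner_eq0.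
Qed.

End SymplecticBasis.

(** * The decomposition *)

Section Decomposition.
Variables (R : realType) (V : vectType R) (omega : {skew_symmetric V}).
Variables (n : nat) (e : (2 * n).-tuple V).
Hypothesis symp_e : symplectic_basis omega e.
Hypothesis dimV : \dim {:V} = (2 * n)%N.
Implicit Types (S T : tensor3 V) (x y z u v w : V) (a : R) (g h : 'End(V)).

(** On torsion-like tensors the cyclic sum is, up to a factor, the alternation; this is its kernel,
    the complement of [lambda3]. *)
Definition cyclic0 : {vspace tensor3 V} := vspace_of (fun T =>
  torsion_like T /\ forall x y z, T x y z + T y z x + T z x y = 0).

Lemma mem_cyclic0 T : T \in cyclic0 <->
  torsion_like T /\ forall x y z, T x y z + T y z x + T z x y = 0.
Proof.
move: T; apply: vspace_ofP; first by split=> x y z; rewrite !tensor3_0E; lra.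
move=> a S T [hS cS] [hT cT]; split=> [|x y z]; first exact: torsion_likeD.
have := congr2 (fun s t => a * s + t) (cS x y z) (cT x y z).
by rewrite mulr0 addr0 => <-; rewrite !tensor3_PE; ring.
Qed.

Lemma torsion_sum : torsion_tensors V = (lambda3 V + cyclic0)%VS.
Proof.
apply/eqP; rewrite eqEsubv; apply/andP; split; last first.
  rewrite subv_add; apply/andP; split; apply/subvP => T.
    by move=> /mem_lambda3[? _]; apply/mem_torsion_tensors.
  by move=> /mem_cyclic0[? _]; apply/mem_torsion_tensors.
apply/subvP => T /mem_torsion_tensors antiT.
(* A third of the cyclic sum is the alternating part. *)
have [A AE] : exists A : tensor3 V, forall x y z,
    A x y z = 3^-1 * (T x y z + T y z x + T z x y) :> R.
  exists (tensor3_of (fun x y z => 3^-1 * (T x y z + T y z x + T z x y))) => x y z.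
  by rewrite tensor3_ofE //; split=> *; rewrite !t3E; ring.
rewrite -(subrKC A T); apply: memv_add.
  apply/mem_lambda3; split=> x y z; rewrite !AE.
    by rewrite (antiT y x) (antiT x z) (antiT z y); ring.
  by rewrite (antiT x z) (antiT z y) (antiT y x); ring.
apply/mem_cyclic0; split=> x y z; rewrite !t3opE !AE; last by field.
by rewrite (antiT y x) (antiT x z) (antiT z y); ring.
Qed.

(** On an alternating form the cyclic sum is three times the form. *)
Lemma lambda3_cyclic0_disjoint : (lambda3 V :&: cyclic0 = 0)%VS.
Proof.
apply/eqP; rewrite -subv0; apply/subvP => T; rewrite memv_cap => /andP[].
move=> /mem_lambda3[antiT asymT] /mem_cyclic0[_ cycT]; rewrite memv0; apply/eqP.
apply: t3P => x y z; rewrite tensor3_0E; have := cycT x y z.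
by rewrite (asymT y) (antiT y x) (antiT z x) (asymT x z); lra.
Qed.

Lemma cyclic0_sum : cyclic0 = (calT1 omega + calT2 e)%VS.
Proof.
apply/eqP; rewrite eqEsubv; apply/andP; split; last first.
  rewrite subv_add; apply/andP; split; apply/subvP => T; last first.
    by move=> /mem_calT2[antiT cycT _]; apply/mem_cyclic0.
  move=> /mem_calT1_tau1[u ->]; apply/mem_cyclic0; split; first exact: tau1_torsion.
  by move=> x y z; rewrite !tau1E (omegaC z x) (omegaC z y) (omegaC y x); ring.
apply/subvP => T /mem_cyclic0[antiT cycT].
have [u tTu] := t12_represents symp_e T.
(* The trace of [tau1] carries the factor [2 n + 1], so this multiple of [u] removes the whole trace
   of [T]. *)
rewrite -(subrKC (tau1 omega ((2 * n).+1%:R^-1 *: u)) T); apply: memv_add.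
  by apply/mem_calT1_tau1; eexists.
have tau1_cyc v x y z : tau1 omega v x y z + tau1 omega v y z x + tau1 omega v z x y = 0 :> R.
  by rewrite !tau1E (omegaC z x) (omegaC z y) (omegaC y x); ring.
apply/mem_calT2; split=> [||z].
- by rewrite addrC -scaleN1r; apply: torsion_likeD => //; apply: tau1_torsion.
- move=> x y z; rewrite !t3opE.
  by have := cycT x y z; have := tau1_cyc ((2 * n).+1%:R^-1 *: u) x y z; lra.
- rewrite addrC -scaleN1r t12_lin (t12_tau1 symp_e) tTu omegaE mulVKf ?pnatr_eq0 //.
  by rewrite mulN1r addNr.
Qed.

Lemma calT12_disjoint : (calT1 omega :&: calT2 e = 0)%VS.
Proof.
apply/eqP; rewrite -subv0; apply/subvP => T; rewrite memv_cap => /andP[].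
move=> /mem_calT1_tau1[u ->] /mem_calT2[_ _ tu]; rewrite memv0.
by rewrite (tau1_inj symp_e (u := u)) ?(linear_at0 (tau1_linear omega)).
Qed.

Lemma lambda3_sum : (1 < n)%N -> lambda3 V = (calT3 omega + calT4 e)%VS.
Proof.
move=> n1; have n1_neq0 : n%:R - 1 != 0 :> R.
  by rewrite subr_eq0 (eqr_nat R n 1) gtn_eqF.
have tau3_asym v x y z : tau3 omega v x y z = - tau3 omega v x z y :> R.
  by rewrite !tau3E (omegaC z y) (omegaC y x) (omegaC z x); ring.
apply/eqP; rewrite eqEsubv; apply/andP; split; last first.
  rewrite subv_add; apply/andP; split; apply/subvP => T; last first.
    by move=> /mem_calT4[antiT asymT _]; apply/mem_lambda3.
  move=> /mem_calT3_tau3[u ->]; apply/mem_lambda3; split; first exact: tau3_torsion.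
  exact: tau3_asym.
apply/subvP => T /mem_lambda3[antiT asymT].
have [u tTu] := t12_represents symp_e T.
(* The scalar inverts the factor [n - 1] of [t12_tau3]; the sign appears because [t12_tau3] has
   [omega u z] where [tTu] has [omega z u]. *)
rewrite -(subrKC (tau3 omega (- (n%:R - 1)^-1 *: u)) T); apply: memv_add.
  by apply/mem_calT3_tau3; eexists.
apply/mem_calT4; split=> [||z].
- by rewrite addrC -scaleN1r; apply: torsion_likeD => //; apply: tau3_torsion.
- by move=> x y z; rewrite !t3opE asymT tau3_asym; ring.
- rewrite addrC -scaleN1r t12_lin (t12_tau3 symp_e) tTu omegaE (omegaC z u).
  by field.
Qed.

Lemma calT34_disjoint : (1 < n)%N -> (calT3 omega :&: calT4 e = 0)%VS.
Proof.
move=> n1; apply/eqP; rewrite -subv0; apply/subvP => T; rewrite memv_cap => /andP[].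
move=> /mem_calT3_tau3[u ->] /mem_calT4[_ _ tu]; rewrite memv0.
by rewrite (tau3_inj symp_e n1 (u := u)) ?(linear_at0 (tau3_linear omega)).
Qed.

Lemma dim_vector_image (F : V -> tensor3 V) (W : {vspace tensor3 V}) :
    linear F -> (forall u, F u = 0 -> u = 0) -> (forall T, T \in W <-> exists u, T = F u) ->
  \dim W = \dim {:V}.
Proof.
move=> F_lin F_inj WF; rewrite -(limg_dim_eq (f := linfun F)).
  congr (\dim _); apply/eqP; rewrite eqEsubv; apply/andP; split; apply/subvP => T.
    move=> /WF[u ->]; apply/memv_imgP; exists u; rewrite ?memvf //.
    by rewrite linfun_fun.
  by move=> /memv_imgP[u _ ->]; apply/WF; exists u; rewrite linfun_fun.
apply/eqP; rewrite -subv0; apply/subvP => u; rewrite memv_cap memv_ker memv0.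
by rewrite linfun_fun // => /andP[_ /eqP/F_inj->].
Qed.

Lemma tau1_eq0 u : tau1 omega u = 0 -> u = 0.
Proof.
move=> u0; apply: (tau1_inj symp_e) => z; rewrite u0.
by rewrite /t12 big1 // => i _; rewrite tensor3_0E.
Qed.

Lemma tau3_eq0 u : (1 < n)%N -> tau3 omega u = 0 -> u = 0.
Proof.
move=> n1 u0; apply: (tau3_inj symp_e n1) => z; rewrite u0.
by rewrite /t12 big1 // => i _; rewrite tensor3_0E.
Qed.

Lemma dim_calT1 : \dim (calT1 omega) = (2 * n)%N.
Proof.
rewrite -dimV; apply: dim_vector_image (tau1_linear omega) tau1_eq0 _.
exact: mem_calT1_tau1.
Qed.

Lemma dim_calT3 : (1 < n)%N -> \dim (calT3 omega) = (2 * n)%N.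
Proof.
move=> n1; rewrite -dimV; apply: dim_vector_image (tau3_linear omega) _ _.
  by move=> u; apply: tau3_eq0.
exact: mem_calT3_tau3.
Qed.

(** Dimension count for [lambda3], T1 and T2 inside the torsion-like tensors; the additive form
    avoids subtraction in [nat]. *)
Lemma dim_calT2 : ('C(2 * n, 3) + (2 * n + \dim (calT2 e)) = 2 * n * 'C(2 * n, 2))%N.
Proof.
rewrite -{1 3 4}dimV -dim_lambda3 -dim_torsion_tensors torsion_sum.
rewrite dimv_disjoint_sum ?lambda3_cyclic0_disjoint // cyclic0_sum.
by rewrite dimv_disjoint_sum ?calT12_disjoint // dim_calT1.
Qed.

Lemma dim_calT4 : (1 < n)%N -> (2 * n + \dim (calT4 e) = 'C(2 * n, 3))%N.
Proof.
move=> n1; rewrite -{2}dimV -dim_lambda3 lambda3_sum //.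
by rewrite dimv_disjoint_sum ?calT34_disjoint // dim_calT3.
Qed.

Lemma bin2_rat m : ('C(m, 2))%:R = m%:R * (m%:R - 1) / 2 :> rat.
Proof.
elim: m => [|m IHm]; first by rewrite bin0n !mul0r.
by rewrite binS bin1 natrD IHm -natr1; field.
Qed.

Lemma bin3_rat m : ('C(m, 3))%:R = m%:R * (m%:R - 1) * (m%:R - 2) / 6 :> rat.
Proof.
elim: m => [|m IHm]; first by rewrite bin0n !mul0r.
by rewrite binS natrD IHm bin2_rat -natr1; field.
Qed.

Lemma dim_calT2_rat : (\dim (calT2 e))%:R = 8 / 3 * (n%:R ^+ 3 - n%:R) :> rat.
Proof.
have := congr1 (fun m => m%:R : rat) dim_calT2.
rewrite !natrD !natrM bin2_rat bin3_rat natrM => dimT2.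
have -> : (\dim (calT2 e))%:R = 2 * n%:R * (2 * n%:R * (2 * n%:R - 1) / 2)
    - 2 * n%:R * (2 * n%:R - 1) * (2 * n%:R - 2) / 6 - 2 * n%:R :> rat.
  by rewrite -dimT2; ring.
by field.
Qed.

Lemma dim_calT4_rat : (1 < n)%N ->
  (\dim (calT4 e))%:R = 2 / 3 * n%:R * (2 * n%:R ^+ 2 - 3 * n%:R - 2) :> rat.
Proof.
move=> n1; have := congr1 (fun m => m%:R : rat) (dim_calT4 n1).
rewrite natrD bin3_rat natrM => dimT4.
have -> : (\dim (calT4 e))%:R =
    2 * n%:R * (2 * n%:R - 1) * (2 * n%:R - 2) / 6 - 2 * n%:R :> rat.
  by rewrite -dimT4; ring.
by field.
Qed.

Lemma torsion_decomposition : (1 < n)%N ->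
  torsion_tensors V = (calT1 omega + calT2 e + calT3 omega + calT4 e)%VS /\
  directv (calT1 omega + calT2 e + calT3 omega + calT4 e).
Proof.
move=> n1; have eqW : torsion_tensors V = (calT1 omega + calT2 e + calT3 omega + calT4 e)%VS.
  by rewrite torsion_sum cyclic0_sum lambda3_sum // addvC addvA.
split=> //; rewrite directvE /= -eqW dim_torsion_tensors dimV -dim_calT2 -dim_calT4 //.
by rewrite dim_calT1 dim_calT3 // addnC addnA.
Qed.

End Decomposition.

(** * Irreducibility of T1, T2 and T3 *)

Section OrbitVanishing.
Variables (R : realType) (V : vectType R) (omega : {skew_symmetric V}).
Hypothesis nondeg : omega_nondeg omega.
Implicit Types (S T : tensor3 V) (x y z u v w : V) (a b : R) (g h : 'End(V)).

Definition vanishes_on_orbit T x y z : Prop :=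
  forall g, symplectomorphism omega g -> T (g x) (g y) (g z) = 0.

Lemma lfun_add_scale g x a v : g (x + a *: v) = g x + a *: g v.
Proof. by rewrite linearD linearZ. Qed.

Lemma lfun_add g x y : g (x + y) = g x + g y.
Proof. exact: linearD. Qed.

Lemma lfun_opp g x : g (- x) = - g x.
Proof. exact: linearN. Qed.

Lemma transv_fix a v x : omega x v = 0 -> x + (a * omega x v) *: v = x.
Proof. by move=> ->; rewrite mulr0 scale0r; apply: addr0. Qed.

(** A symplectomorphism composed with a transvection is again symplectic, so the moved triple lies
    in the same orbit. *)
Lemma vanishes_transv T x y z a v : vanishes_on_orbit T x y z ->
  vanishes_on_orbit T (x + (a * omega x v) *: v) (y + (a * omega y v) *: v)
    (z + (a * omega z v) *: v).
Proof.
move=> Tg g sg.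
have := Tg _ (sympl_comp nondeg sg (transv_sympl nondeg a v)).
by rewrite !comp_lfunE !transvE.
Qed.

(** A transvection along [w] orthogonal to [x] fixes [x] and adds a multiple of [w] to [y];
    subtracting the two vanishing values isolates [w]. A [v] orthogonal to [y] is the difference of
    [v + w] and [w]. *)
Lemma vanishes_move2 T x y v : (forall a, y != a *: x) -> omega x v = 0 -> 
  vanishes_on_orbit T x y x -> vanishes_on_orbit T x v x.
Proof.
move=> yNx xv Txy.
have step w : omega x w = 0 -> omega y w != 0 -> vanishes_on_orbit T x w x.
  move=> xw yw g sg; have := vanishes_transv 1 w Txy sg.
  rewrite (transv_fix _ xw) mul1r lfun_add_scale !t3E (Txy g sg) add0r.
  by move=> /eqP; rewrite mulf_eq0 (negPf yw) => /eqP.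
have [yv|yv] := eqVneq (omega y v) 0; last exact: step.
have [w [yw xw]] := exists_dual_orth nondeg yNx.
move=> g sg; have Tvw := step (v + w); have Tw := step w.
move: Tvw; rewrite !omegaE xv yv yw xw !add0r => /(_ erefl (oner_neq0 R) g sg).
by rewrite lfun_add !t3E Tw ?yw ?oner_neq0 // addr0.
Qed.

(** Two slots move at once, so the transvections with parameters 1 and -1 are added: the linear
    terms cancel and the quadratic one remains. When [omega x v = 0], the parallelogram identity for
    [v + w] and [v - w] gives the value at [v]. *)
Lemma vanishes_move13 T x y v : (forall a, x != a *: y) -> omega y v = 0 ->
  vanishes_on_orbit T x y x -> vanishes_on_orbit T v y v.
Proof.
move=> xNy yv Txy.
have step w : omega y w = 0 -> omega x w != 0 -> vanishes_on_orbit T w y w.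
  move=> yw xw g sg; have T0 := Txy g sg.
  have := vanishes_transv 1 w Txy sg; have := vanishes_transv (-1) w Txy sg.
  rewrite !(transv_fix _ yw) !lfun_add_scale !t3E T0.
  move=> Tp Tm.
  suff /eqP : omega x w ^+ 2 * T (g w) (g y) (g w) = 0 :> R.
    by rewrite mulf_eq0 expf_eq0 (negPf xw) /= => /eqP.
  by lra.
have [xv|xv] := eqVneq (omega x v) 0; last exact: step.
have [w [xw yw]] := exists_dual_orth nondeg xNy.
move=> g sg; have Tw : T (g w) (g y) (g w) = 0 by apply: step; rewrite ?xw ?oner_neq0.
have Tp : T (g (v + w)) (g y) (g (v + w)) = 0.
  by apply: step => //; rewrite !omegaE ?yv ?yw ?addr0 // xv xw add0r oner_neq0.
have Tm : T (g (v - w)) (g y) (g (v - w)) = 0.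
  apply: step => //; rewrite !omegaE ?yv ?yw ?subr0 // xv xw sub0r.
  by rewrite oppr_eq0 oner_neq0.
by move: Tp Tm; rewrite !(lfun_add, lfun_opp) !t3E Tw; lra.
Qed.

(* Reaches (x, y) from (x0, y0) through (x0, v) and (x, v), where v is
   orthogonal to both x0 and x. *)
Lemma vanishes_all_orth T x0 y0 x y : torsion_like T ->
    x0 != 0 -> omega x0 y0 = 0 -> (forall a, y0 != a *: x0) ->
    vanishes_on_orbit T x0 y0 x0 -> omega x y = 0 ->
  T x y x = 0.
Proof.
move=> antiT x0_neq0 xy0 y0Nx0 T0 xy.
suff Txy : vanishes_on_orbit T x y x.
  by have := Txy _ (sympl_id nondeg); rewrite !id_lfunE.
have base v : omega x0 v = 0 -> vanishes_on_orbit T x0 v x0.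
  by move=> xv; apply: vanishes_move2 y0Nx0 xv T0.
have triv a : vanishes_on_orbit T x (a *: x) x.
  move=> g sg; have Tx : T (g x) (g x) (g x) = 0 :> R.
    by have := antiT (g x) (g x) (g x); lra.
  by rewrite linearZ /= t3E Tx mulr0.
have [[a ->]//|yNx] := boolp.pselect (exists a, y = a *: x).
have move_y v : omega x v = 0 -> (forall a, v != a *: x) -> vanishes_on_orbit T x v x ->
    vanishes_on_orbit T x y x.
  by move=> xv vNx Txv; apply: vanishes_move2 vNx xy Txv.
have yNx' a : y != a *: x by apply/eqP => ya; apply: yNx; exists a.
have [[a xa]|xNx0] := boolp.pselect (exists a, x = a *: x0).
  have [a0|a0] := eqVneq a 0.
    by move=> g sg; rewrite xa a0 scale0r linear0 t3_zero1.
  have yx0 : omega x0 y = 0.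
    by move: xy; rewrite xa omegaE => /eqP; rewrite mulf_eq0 (negPf a0) => /eqP.
  by move=> g sg; rewrite xa linearZ /= !t3E (base y yx0 g sg) !mulr0.
have xNx0' a : x != a *: x0 by apply/eqP => xa; apply: xNx0; exists a.
have through v : omega x0 v = 0 -> omega x v = 0 -> (forall a, x0 != a *: v) ->
    (forall a, v != a *: x) -> vanishes_on_orbit T x y x.
  move=> x0v xv x0Nv vNx; apply: (move_y v) => //.
  by apply: vanishes_move13 (base v x0v); rewrite // omegaC xv oppr0.
have [x0x|x0x] := eqVneq (omega x0 x) 0.
  (* Here [x0] and [x] are orthogonal and independent: their sum is orthogonal to both and
     proportional to neither. *)
  apply: (through (x0 + x)).
  - by rewrite omegaE omegaxx x0x addr0.
  - by rewrite omegaE omegaxx omegaC x0x oppr0 addr0.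
  - move=> a; apply/eqP => x0a; have [a0|a0] := eqVneq a 0.
      by move: x0_neq0; rewrite x0a a0 scale0r eqxx.
    case/eqP: (xNx0' (a^-1 * (1 - a))); have ax : (1 - a) *: x0 = a *: x.
      by rewrite scalerBl scale1r {1}x0a scalerDr addrAC subrr add0r.
    by rewrite -scalerA ax scalerA mulVf // scale1r.
  - move=> a; apply/eqP => x0a; have [a1|a1] := eqVneq (a - 1) 0.
      move: x0_neq0; rewrite -(addrK x x0) x0a; move/subr0_eq: a1 => ->.
      by rewrite scale1r subrr eqxx.
    case/eqP: (xNx0' (a - 1)^-1); rewrite -(addrK x x0) x0a.
    by rewrite -[X in _ *: (_ - X)]scale1r -scalerBl scalerA mulVf // scale1r.
(* Correcting [y] by a multiple of [x] makes it orthogonal to [x0] and keeps it orthogonal to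
   [x]. *)
pose c := omega x0 y / omega x0 x.
apply: (through (y - c *: x)).
- by rewrite !omegaE /c divfK // subrr.
- by rewrite !omegaE omegaxx xy mulr0 subr0.
- move=> a; apply: contraNneq x0x => ->.
  by rewrite !omegaE omegaxx (omegaC y) xy; apply/eqP; ring.
- by move=> a; rewrite subr_eq -scalerDl.
Qed.

End OrbitVanishing.

(** * Recognition of T1 from orthogonal pairs, and the three irreducibility proofs *)

Section IrreducibleT2.
Variables (R : realType) (V : vectType R) (omega : {skew_symmetric V}).
Variables (n : nat) (e : (2 * n).-tuple V).
Hypothesis symp_e : symplectic_basis omega e.
Hypothesis dimV : \dim {:V} = (2 * n)%N.
Implicit Types (S T : tensor3 V) (x y z u v w : V) (a : R) (g h : 'End(V)).

Let nondeg := symp_nondeg symp_e.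

Lemma exists_nonorth2 x z : x != 0 -> z != 0 ->
  exists w, omega x w != 0 /\ omega z w != 0.
Proof.
move=> /(exists_dual nondeg)[w1 xw1] /(exists_dual nondeg)[w2 zw2].
have [zw1|zw1] := eqVneq (omega z w1) 0; last by exists w1; rewrite xw1 oner_neq0.
have [xw2|xw2] := eqVneq (omega x w2) 0; last by exists w2; rewrite zw2 oner_neq0.
by exists (w1 + w2); rewrite !omegaE xw1 zw1 xw2 zw2 add0r addr0 oner_neq0.
Qed.

(* Polarization gives T(x,y,x) = omega(x,y) gam(x) and
   T(x,y,z) + T(z,y,x) = omega(x,y) gam(z) + omega(z,y) gam(x), first for
   omega(x,z) <> 0; hence gam is linear, and the cyclic identity recovers T
   from the left-hand sides. *)
Lemma calT1_of_orth T : T \in cyclic0 V ->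
  (forall x y, omega x y = 0 -> T x y x = 0) -> T \in calT1 omega.
Proof.
move=> /mem_cyclic0[antiT cycT] orthT.
have T11 x y : T x x y = 0 :> R by have := antiT x x y; lra.
have S_orth x y z : omega x y = 0 -> omega z y = 0 -> T x y z + T z y x = 0.
  move=> xy zy; have := orthT (x + z) y; rewrite omegaE xy zy addr0 => /(_ erefl).
  by rewrite !t3E !orthT // addr0 add0r.
have [gam gamE gam0] : exists2 gam, forall x y, T x y x = omega x y * gam x
    & gam 0 = 0.
  (* At [x = 0] any constant fits; it is set to 0, as a linear [gam] requires. *)
  suff /boolp.choice[gam Pgam] : forall x, exists c,
      (forall y, T x y x = omega x y * c) /\ (x = 0 -> c = 0).
    by exists gam => [x|]; [have [] := Pgam x | have [_ ->] := Pgam 0].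
  move=> x; have [->|x0] := eqVneq x 0.
    by exists 0; split=> // y; rewrite t3_zero1 mulr0.
  have [d xd] := exists_dual nondeg x0; exists (T x d x).
  split=> [y|x0']; last by rewrite x0' eqxx in x0.
  have := orthT x (y - omega x y *: d); rewrite !omegaE xd mulr1 subrr => /(_ erefl).
  by rewrite !t3E; lra.
have S_nonorth x y z : omega x z != 0 ->
    T x y z + T z y x = omega x y * gam z + omega z y * gam x.
  (* These coefficients make [y - a *: x - b *: z] orthogonal to both [x] and [z]. *)
  move=> xz; pose a := omega y z / omega x z; pose b := omega x y / omega x z.
  have ax : a * omega x z = omega y z by rewrite /a divfK.
  have bx : b * omega x z = omega x y by rewrite /b divfK.
  have := @S_orth x (y - a *: x - b *: z) z.
  rewrite !omegaE !omegaxx bx (omegaC z x) mulrN ax (omegaC z y).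
  rewrite !mulr0 !subr0 subrr opprK addNr => /(_ erefl erefl).
  rewrite !t3E !T11 (antiT x z z) (antiT z x x) !gamE (omegaC z x) -ax -bx; lra.
(* Two evaluations of [T] at [(z + w, w, z + w)] are compared. *)
have gam_add z w : omega z w != 0 -> gam (z + w) = gam z + gam w.
  move=> zw; apply: (mulfI zw); have := S_nonorth z w w zw.
  have := gamE (z + w) w; rewrite !t3E !gamE !omegaE !omegaxx.
  by lra.
have SE x y z : T x y z + T z y x = omega x y * gam z + omega z y * gam x.
  have [xz|] := eqVneq (omega x z) 0; last exact: S_nonorth.
  have [->|x0] := eqVneq x 0; first by rewrite t3_zero1 t3_zero3 gam0 linear0l; ring.
  have [->|z0] := eqVneq z 0; first by rewrite t3_zero1 t3_zero3 gam0 linear0l; ring.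
  (* With [w] orthogonal to neither [x] nor [z], the identity at [w] is subtracted from the one at
     [z + w]. *)
  have [w [xw zw]] := exists_nonorth2 x0 z0.
  have := S_nonorth x y w xw; have := S_nonorth x y (z + w).
  rewrite gam_add // !t3E !omegaE xz add0r => /(_ xw); lra.
have [V0|[x0 x0_neq0]] : (forall x, x = 0) \/ exists x, x != 0.
- case: (boolp.pselect (exists x, x != 0)) => [|noN]; [by right | left => x].
  by apply/eqP; apply: boolp.contrapT => /negP x0; apply: noN; exists x.
- by apply/mem_calT1; split=> //; exists 0 => x y z; rewrite (V0 x) t3_zero1 !linear0l; ring.
have [d xd] := exists_dual nondeg x0_neq0.
(* Since [omega x0 d = 1], [SE] at [(x0, d, x)] expresses [gam x] through terms linear in [x]. *)
have [U gamU] : exists U, forall x, gam x = omega x U.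
  apply: (omega_represents symp_e) => a x y.
  have := SE x0 d (a *: x + y); have := SE x0 d x; have := SE x0 d y.
  by rewrite !t3E !omegaE xd; nra.
(* The element of T1 with parameter [U] takes the value [3 * omega x y * omega x U] at [(x, y, x)],
   hence the third. *)
apply/mem_calT1; split=> //; exists (3^-1 *: U) => x y z; rewrite !omegaE -!gamU.
have := SE x y z; have := SE y x z; have := cycT x y z.
by rewrite (antiT y x) (antiT z y) (omegaC y x) (omegaC z x) (omegaC z y); lra.
Qed.

Lemma calT2_submodule : Sp_submodule omega (calT2 e).
Proof.
move=> g sg T /mem_calT2[antiT cycT tT]; apply/mem_calT2; split=> [|x y z|z].
- exact: torsion_like_act.
- by rewrite !tensor3_actE.
- by rewrite (t12_act symp_e).
Qed.

(** Fact (ii) for T2, with the Young symmetrization of hook shape. Orthogonality of [u] and [v]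
    keeps the factors [omega _ u] fixed under the transvection along [v]. *)
Lemma hook_mem (U : {vspace tensor3 V}) T u v : Sp_submodule omega U ->
    torsion_like T -> T \in U -> omega u v = 0 -> T u v u <> 0 ->
  -1 *: rank1 omega v u u + rank1 omega u v u \in U.
Proof.
move=> subU antiT TU uv /eqP Tuvu.
have T11 x y : T x x y = 0 :> R by have := antiT x x y; lra.
(* The second difference of T along the transvection of u, then the first along v. *)
have [S1 S1U S1E] : exists2 S1, S1 \in U & forall x y z, S1 x y z =
    2 * omega z u * (omega x u * T u y u - omega y u * T u x u) :> R.
  have [Tp TpU TpE] := exists_transv_pullback nondeg 1 u subU TU.
  have [Tm TmU TmE] := exists_transv_pullback nondeg (-1) u subU TU.
  exists (Tp + Tm - 2 *: T) => [|x y z]; first by rewrite memvB ?memvZ ?memvD.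
  by rewrite !t3opE TpE TmE !t3E !T11 (antiT x u u); ring.
have [S2 S2U S2E] := exists_transv_pullback nondeg 1 v subU S1U.
have -> : -1 *: rank1 omega v u u + rank1 omega u v u = (2 * T u v u)^-1 *: (S2 - S1).
  apply: t3P => x y z; rewrite !t3opE S2E !S1E !rank1E !omegaE (omegaC v u) uv !t3E.
  by field.
by rewrite memvZ ?memvB.
Qed.

Lemma calT2_irreducible : (1 < n)%N -> Sp_irreducible omega (calT2 e).
Proof.
move=> n1; have n0 := ltnW n1.
pose u := eps e (Ordinal n0, true); pose v := eps e (Ordinal n1, true).
have uv : omega u v = 0 by have [_ ij] := symp_e; have [] := ij (Ordinal n0) (Ordinal n1).
have vNu a : v != a *: u.
  apply/eqP => /(congr1 (fun x => omega x (del e (Ordinal n1, true)))).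
  rewrite omegaE /u /v !(omega_eps_del symp_e) eqxx /= mulr0.
  by apply/eqP; rewrite oner_neq0.
(* The scalar is -2 because each of the two terms of [H], moved by [g], pairs to
   [- T (g u) (g v) (g u)]. *)
apply: (irreducible_criterion nondeg (eps := eps e) (del := del e)
  (H := -1 *: rank1 omega v u u + rank1 omega u v u) (u := u) (v := v) (w := u) (a := -2)).
- by rewrite oppr_eq0 pnatr_eq0.
- exact: calT2_submodule.
(* The dimension [8 / 3 (n^3 - n)] is positive for [n >= 2]. *)
- apply/eqP => T20; have := dim_calT2_rat symp_e dimV; rewrite T20 dimv0.
  have : 2 <= n%:R :> rat by rewrite (ler_nat _ 2).
  by nra.
- move=> g T sg /mem_calT2[antiT _ _].
  rewrite act_lin !act_rank1 //.
  rewrite pairing_linl !(pairing_rank1 (eps_expand symp_e)) (antiT (g v)); ring.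
- move=> U T subU leU TU; apply: hook_mem => //.
  by have /mem_calT2[] := subvP leU _ TU.
(* Vanishing on the orbit puts [T] in T1, which meets T2 only in 0. *)
- move=> T T2 T0; have /mem_calT2[antiT cycT _] := T2.
  apply/eqP; rewrite -memv0 -(calT12_disjoint symp_e) memv_cap T2 andbT.
  apply: calT1_of_orth => [|x y xy]; first by apply/mem_cyclic0.
  apply: (vanishes_all_orth nondeg antiT _ uv vNu T0 xy).
  exact: eps_neq0 symp_e _.
Qed.

Lemma calT1_irreducible : (0 < n)%N -> Sp_irreducible omega (calT1 omega).
Proof.
move=> n0; apply: (irreducible_vector_image nondeg (F := tau1 omega)).
- exact: tau1_linear.
- exact: tau1_eq0 symp_e.
- by move=> g u; apply: act_tau1 symp_e _ _.
- exact: mem_calT1_tau1.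
- by exists (eps e (Ordinal n0, true)); apply: eps_neq0 symp_e _.
Qed.

Lemma calT3_irreducible : (1 < n)%N -> Sp_irreducible omega (calT3 omega).
Proof.
move=> n1; apply: (irreducible_vector_image nondeg (F := tau3 omega)).
- exact: tau3_linear.
- by move=> u; apply: tau3_eq0 symp_e _ n1.
- by move=> g u; apply: act_tau3 symp_e _ _.
- exact: mem_calT3_tau3.
- by exists (eps e (Ordinal n1, true)); apply: eps_neq0 symp_e _.
Qed.

End IrreducibleT2.

(** * Irreducibility of T4 *)

Section Alternating.
Variables (R : realType) (V : vectType R) (omega : {skew_symmetric V}).
Hypothesis nondeg : omega_nondeg omega.
Variable T : tensor3 V.
Hypotheses (anti12 : torsion_like T) (anti23 : forall x y z, T x y z = - T x z y).
Implicit Types (S : tensor3 V) (x y z u v w : V) (a b : R) (g h : 'End(V)).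

Lemma alt_eq12 x y : T x x y = 0 :> R.
Proof. by have := anti12 x x y; lra. Qed.
Lemma alt_eq23 x y : T x y y = 0 :> R.
Proof. by have := anti23 x y y; lra. Qed.
Lemma alt_eq13 x y : T x y x = 0 :> R.
Proof. by rewrite anti23 alt_eq12 oppr0. Qed.
Lemma alt_rot x y z : T y z x = T x y z :> R.
Proof. by rewrite anti23 anti12 opprK. Qed.

Lemma vanishes_swap x y z : vanishes_on_orbit omega T x y z -> vanishes_on_orbit omega T y x z.
Proof. by move=> T0 g sg; rewrite anti12 T0 ?oppr0. Qed.

Lemma vanishes_rot x y z : vanishes_on_orbit omega T x y z -> vanishes_on_orbit omega T y z x.
Proof. by move=> T0 g sg; rewrite alt_rot T0. Qed.

(** The argument of [vanishes_move2] applies; [w] provides a direction that moves [x] and fixes [y]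
    and [z]. *)
Lemma vanishes_move3 x y z v w : omega y w = 0 -> omega z w = 0 -> omega x w != 0 ->
    omega y v = 0 -> omega z v = 0 ->
  vanishes_on_orbit omega T x y z -> vanishes_on_orbit omega T v y z.
Proof.
move=> yw zw xw yv zv T0.
have step t : omega y t = 0 -> omega z t = 0 -> omega x t != 0 ->
    vanishes_on_orbit omega T t y z.
  move=> yt zt xt g sg; have := vanishes_transv nondeg 1 t T0 sg.
  rewrite (transv_fix _ yt) (transv_fix _ zt) mul1r lfun_add_scale !t3E (T0 g sg) add0r.
  by move=> /eqP; rewrite mulf_eq0 (negPf xt) => /eqP.
have [xv|] := eqVneq (omega x v) 0; last exact: step.
move=> g sg; have Tw := step w yw zw xw g sg.
have := step (v + w); rewrite !omegaE yv yw zv zw xv !addr0 add0r => /(_ erefl erefl xw g sg).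
by rewrite lfun_add !t3E Tw addr0.
Qed.

(** Antisymmetrization of [rank1], nested as [a *: S + T] so that [act_lin] and [pairing_linl]
    rewrite it term by term. *)
Definition alt3 u v w : tensor3 V :=
  -1 *: rank1 omega u w v + (-1 *: rank1 omega v u w + (-1 *: rank1 omega w v u +
   (1 *: rank1 omega v w u + (1 *: rank1 omega w u v + rank1 omega u v w)))).

Lemma act_alt3 g u v w : symplectomorphism omega g ->
  tensor3_act g (alt3 u v w) = alt3 (g u) (g v) (g w).
Proof.
by move=> sg; rewrite /alt3 !act_lin !act_rank1.
Qed.

(** Fact (ii) for T4. Each difference replaces one argument by its direction; alternation kills
    repeated directions, and isotropy leaves the coefficients already produced unchanged. After [w],
    [v] and [u] only multiples of [T u v w] remain. *)
Lemma alt3_mem (U : {vspace tensor3 V}) u v w : Sp_submodule omega U -> T \in U ->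
    omega u v = 0 -> omega u w = 0 -> omega v w = 0 -> T u v w <> 0 ->
  alt3 u v w \in U.
Proof.
move=> subU TU uv uw vw /eqP c_neq0.
have diff t S : S \in U -> exists2 S', S' \in U & forall x y z, S' x y z =
    S (x + omega x t *: t) (y + omega y t *: t) (z + omega z t *: t) - S x y z :> R.
  move=> SU; have [S' S'U S'E] := exists_transv_pullback nondeg 1 t subU SU.
  exists (S' - S) => [|x y z]; first by rewrite memvB.
  by rewrite !t3opE S'E !mul1r.
have [S1 S1U S1E] := diff w T TU.
have [S2 S2U S2E] := diff v S1 S1U.
have [S3 S3U S3E] := diff u S2 S2U.
have d1E x y z : S1 x y z =
    omega x w * T w y z + omega y w * T x w z + omega z w * T x y w :> R.
  by rewrite S1E !t3E !alt_eq12 !alt_eq13 !alt_eq23; ring.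
have d2E x y z : S2 x y z =
    (omega z w * omega y v - omega y w * omega z v) * T v w x
    + (omega x w * omega z v - omega z w * omega x v) * T v w y
    + (omega y w * omega x v - omega x w * omega y v) * T v w z :> R.
  rewrite S2E !d1E !omegaE vw !t3E !alt_eq12 !alt_eq13 !alt_eq23.
  rewrite (anti12 w v z) (alt_rot v w y) (anti23 x w v) (alt_rot w x v) (alt_rot v w x).
  by rewrite (anti23 v y w); ring.
have -> : alt3 u v w = (T u v w)^-1 *: S3.
  apply: t3P => x y z; rewrite t3_scaleE S3E !d2E !omegaE uv uw !t3E (alt_rot u v w).
  by rewrite !t3opE !rank1E; field.
by rewrite memvZ.
Qed.

(** Each of the six signed terms contributes [- T u v w]. *)
Lemma pairing_alt3 (I : finType) (eps del : I -> V) u v w :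
    (forall x, x = \sum_i omega x (del i) *: eps i) ->
  pairing eps del (alt3 u v w) T = -6 * T u v w.
Proof.
move=> expand; rewrite !pairing_linl !(pairing_rank1 expand).
rewrite (alt_rot u v w) -(alt_rot w u v) (anti23 u w) (anti12 v u) -(alt_rot w v u).
by rewrite (anti12 v u w); ring.
Qed.

End Alternating.

(** * Basis triples from distinct hyperbolic planes, and the irreducibility of T4 *)

Section IrreducibleT4.
Variables (R : realType) (V : vectType R) (omega : {skew_symmetric V}).
Variables (n : nat) (e : (2 * n).-tuple V).
Hypothesis symp_e : symplectic_basis omega e.
Hypothesis dimV : \dim {:V} = (2 * n)%N.
Implicit Types (S T : tensor3 V) (x y z u v w : V) (a : R) (g h : 'End(V)).

Let nondeg := symp_nondeg symp_e.
Notation eps := (eps e).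
Notation del := (del e).

Section Vanishing.
Variable T : tensor3 V.
Hypothesis T4 : T \in calT4 e.

Let anti12 : torsion_like T. Proof. by have /mem_calT4[] := T4. Qed.
Let anti23 x y z : T x y z = - T x z y. Proof. by have /mem_calT4[] := T4. Qed.

(** The direction [del i] is orthogonal to every basis vector other than [eps i], so it moves the
    first argument alone. *)
Lemma vanishes_move_eps i j k v : i.1 != j.1 -> i.1 != k.1 ->
    omega (eps j) v = 0 -> omega (eps k) v = 0 ->
  vanishes_on_orbit omega T (eps i) (eps j) (eps k) ->
  vanishes_on_orbit omega T v (eps j) (eps k).
Proof.
move=> ij ik jv kv; apply: (vanishes_move3 nondeg (w := del i)) => //.
- rewrite (omega_eps_del symp_e) (_ : (j == i) = false) //.
  by apply: contraNF ij => /eqP->.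
- rewrite (omega_eps_del symp_e) (_ : (k == i) = false) //.
  by apply: contraNF ik => /eqP->.
- by rewrite (omega_eps_del symp_e) eqxx oner_neq0.
Qed.

(** The component [i.1] labels the hyperbolic plane of [eps i]. The targets are inserted one at a
    time, each replacing the entry from its own plane if there is one, so that the planes stay
    distinct; permutations bring that entry to the first slot. *)
Lemma vanishes_all_eps i0 j0 k0 : i0.1 != j0.1 -> i0.1 != k0.1 -> j0.1 != k0.1 ->
    vanishes_on_orbit omega T (eps i0) (eps j0) (eps k0) ->
  forall i j k, i.1 != j.1 -> i.1 != k.1 -> j.1 != k.1 ->
    vanishes_on_orbit omega T (eps i) (eps j) (eps k).
Proof.
move=> ij0 ik0 jk0 P0 i j k ij ik jk.
pose P i j k := vanishes_on_orbit omega T (eps i) (eps j) (eps k).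
have move_to p q r s : p.1 != q.1 -> p.1 != r.1 -> s.1 != q.1 -> s.1 != r.1 ->
    P p q r -> P s q r.
  move=> pq pr sq sr; apply: vanishes_move_eps => //.
    by rewrite (omega_eps_eps symp_e) // eq_sym.
  by rewrite (omega_eps_eps symp_e) // eq_sym.
have swap p q r : P p q r -> P q p r by apply: vanishes_swap.
have rot p q r : P p q r -> P q r p by apply: vanishes_rot.
have sym p q : p != q -> q != p :> 'I_n by rewrite eq_sym.
have [ji0 ki0 kj0] := And3 (sym _ _ ij0) (sym _ _ ik0) (sym _ _ jk0).
have [ji ki kj] := And3 (sym _ _ ij) (sym _ _ ik) (sym _ _ jk).
have [j1 [k1 [ij1 ik1 jk1 P1]]] : exists j1 k1,
    [/\ i.1 != j1.1, i.1 != k1.1, j1.1 != k1.1 & P i j1 k1].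
  have [eij|nij] := eqVneq i.1 j0.1.
    exists i0, k0; rewrite eij; split=> //.
    by apply: (move_to j0); rewrite ?eij //; apply: swap.
  have [eik|nik] := eqVneq i.1 k0.1.
    exists i0, j0; rewrite eik; split=> //.
    by apply: (move_to k0); rewrite ?eik //; apply/rot/rot.
  by exists j0, k0; split=> //; apply: (move_to i0).
have [ji1 ki1 kj1] := And3 (sym _ _ ij1) (sym _ _ ik1) (sym _ _ jk1).
have [k2 [ik2 jk2 P2]] : exists k2, [/\ i.1 != k2.1, j.1 != k2.1 & P j i k2].
  have [ejk|njk] := eqVneq j.1 k1.1.
    exists j1; rewrite ejk; split=> //.
    by apply: (move_to k1); rewrite ?ejk //; apply/rot/rot.
  by exists k1; split=> //; apply: (move_to j1) => //; apply: swap.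
have [ki2 kj2] := conj (sym _ _ ik2) (sym _ _ jk2).
by apply/rot/(move_to k2) => //; apply/rot/rot/swap.
Qed.

(* The isotropic triples (e_i + e_j, f_i - f_j, e_k) show that T(e_i, f_i, e_k)
   does not depend on i, so the vanishing trace forces it to be 0. *)
Lemma calT4_eq0 i0 j0 k0 : i0.1 != j0.1 -> i0.1 != k0.1 -> j0.1 != k0.1 ->
  vanishes_on_orbit omega T (eps i0) (eps j0) (eps k0) -> T = 0.
Proof.
move=> ij0 ik0 jk0 /(vanishes_all_eps ij0 ik0 jk0) P.
have at_id x y z : vanishes_on_orbit omega T x y z -> T x y z = 0 :> R.
  by move=> T0; have := T0 _ (sympl_id nondeg); rewrite !id_lfunE.
pose pair i k : R := T (eps (i, true)) (eps (i, false)) (eps k).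
have pair_same k : pair k.1 k = 0.
  by rewrite /pair; case: k => k []; rewrite ?(alt_eq13 anti12 anti23) ?(alt_eq23 anti23).
have pair_const i j k : i != j -> i != k.1 -> j != k.1 -> pair i k = pair j k.
  move=> ij ik jk; pose E i := eps (i, true); pose F i := eps (i, false).
  have EF l m : omega (E l) (F m) = (l == m)%:R.
    by have [_ sl] := symp_e; have [] := sl l m.
  have EE l m : omega (E l) (E m) = 0 by have [_ sl] := symp_e; have [] := sl l m.
  have kF l : l != k.1 -> omega (eps k) (F l) = 0.
    by move=> lk; rewrite (omega_eps_eps symp_e) // eq_sym.
  have kE l : l != k.1 -> omega (eps k) (E l) = 0.
    by move=> lk; rewrite (omega_eps_eps symp_e) // eq_sym.
  (* The isotropic triple is reached in two moves: [E i] becomes [E i + E j], then [E j] becomes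
     [F i - F j]. *)
  have P1 : vanishes_on_orbit omega T (E i + E j) (E j) (eps k).
    apply: (@vanishes_move_eps (i, true) (j, true)) => //.
    - by rewrite omegaE !EE addr0.
    - by rewrite omegaE !kE // addr0.
    - exact: P.
  have := at_id (F i - F j) (E i + E j) (eps k).
  have ji : (j == i) = false by rewrite eq_sym; apply: negPf.
  have w_orth : omega (E i + E j) (F i - F j) = 0.
    by rewrite !omegaE !EF !eqxx (negPf ij) ji; ring.
  have k_orth : omega (eps k) (F i - F j) = 0 by rewrite !omegaE !kF // subr0.
  have j_orth : omega (E j) (F i - F j) != 0.
    by rewrite !omegaE !EF eqxx ji sub0r oppr_eq0 oner_neq0.
  move=> /(_ (vanishes_move3 nondeg w_orth k_orth j_orth w_orth k_orth
    (vanishes_swap anti12 P1))).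
  have := at_id _ _ _ (P (i, false) (j, true) k ij ik jk).
  have := at_id _ _ _ (P (j, false) (i, true) k (negbT ji) jk ik).
  rewrite !t3E /E /F /pair (anti12 (eps (i, true)) (eps (i, false))).
  by rewrite (anti12 (eps (j, true)) (eps (j, false))); lra.
have pair0 i k : pair i k = 0.
  have [->|ik] := eqVneq i k.1; first exact: pair_same.
  have /mem_calT4[_ _ /(_ (eps k))] := T4.
  (* The term at [k.1] is zero and the others are equal, so the trace is a multiple of [pair i k];
     the index [i] itself shows that the multiplicity is nonzero. *)
  rewrite /t12 -[LHS]/(\sum_l pair l k) (bigD1 k.1) //= pair_same add0r.
  rewrite (eq_bigr (fun=> pair i k)) => [|j jk].
    rewrite sumr_const => /eqP; rewrite mulrn_eq0 => /orP[/eqP/card0_eq/(_ i)|/eqP//].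
    by rewrite -topredE /= ik.
  by have [->//|ji] := eqVneq j i; apply: pair_const.
(* It remains to treat two arguments from one plane: either they coincide or the value is [pair] up
   to sign. *)
have same i j k : i.1 = j.1 -> T (eps i) (eps j) (eps k) = 0 :> R.
  case: i j => [i b] [j c] /= <-; have := pair0 i k; rewrite /pair.
  by case: b c => [] [] pik; rewrite ?(alt_eq12 anti12) // anti12 pik oppr0.
apply: (t3_eps_ext symp_e) => i j k; rewrite tensor3_0E.
have [ij|nij] := eqVneq i.1 j.1; first exact: same.
have [jk|njk] := eqVneq j.1 k.1.
  by rewrite -(alt_rot anti12 anti23) same.
have [ik|nik] := eqVneq i.1 k.1; first by rewrite anti23 same ?oppr0.
exact/at_id/P.
Qed.

End Vanishing.

Lemma calT4_submodule : Sp_submodule omega (calT4 e).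
Proof.
move=> g sg T /mem_calT4[antiT asymT tT]; apply/mem_calT4; split=> [|x y z|z].
- exact: torsion_like_act.
- by rewrite !tensor3_actE.
- by rewrite (t12_act symp_e).
Qed.

Lemma calT4_irreducible : (2 < n)%N -> Sp_irreducible omega (calT4 e).
Proof.
move=> n2; have n1 := ltnW n2; have n0 := ltnW n1.
pose i0 : 'I_n * bool := (Ordinal n0, true).
pose i1 : 'I_n * bool := (Ordinal n1, true).
pose i2 : 'I_n * bool := (Ordinal n2, true).
apply: (irreducible_criterion nondeg (eps := eps) (del := del)
  (H := alt3 omega (eps i0) (eps i1) (eps i2)) (u := eps i0) (v := eps i1) (w := eps i2)
  (a := -6)).
- by rewrite oppr_eq0 pnatr_eq0.
- exact: calT4_submodule.
(* The factor [2 n^2 - 3 n - 2 = (2 n + 1) (n - 2)] is positive for [n >= 3]. *)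
- apply/eqP => T40; have := dim_calT4_rat symp_e dimV n1; rewrite T40 dimv0.
  have : 3 <= n%:R :> rat by rewrite (ler_nat _ 3).
  by nra.
- move=> g T sg /mem_calT4[anti12 anti23 _].
  by rewrite act_alt3 // (pairing_alt3 anti12 anti23) //; apply: eps_expand symp_e.
- move=> U T subU leU TU; have /mem_calT4[anti12 anti23 _] := subvP leU _ TU.
  by apply: alt3_mem; rewrite // (omega_eps_eps symp_e).
- by move=> T T4 T0; apply: (calT4_eq0 T4 (i0 := i0) (j0 := i1) (k0 := i2)).
Qed.

End IrreducibleT4.

(** For [n = 1] every alternating 3-form vanishes, so T3 and T4 are 0 while the formulas would give
    2 and -2; hence the bound [2 <= n] on these two dimensions. *)
Theorem theorem5p2 (R : realType) (V : vectType R)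
    (omega : {skew_symmetric V}) (n : nat) (e : (2 * n).-tuple V) :
  is_psymplectic omega ->
  (0 < n)%N ->
  \dim {:V} = (2 * n)%N ->
  symplectic_basis omega e ->
  [/\ (3 <= n)%N ->
        [/\ torsion_tensors V = (calT1 omega + calT2 e + calT3 omega + calT4 e)%VS,
            directv (calT1 omega + calT2 e + calT3 omega + calT4 e)
          & [/\ Sp_irreducible omega (calT1 omega), Sp_irreducible omega (calT2 e),
                Sp_irreducible omega (calT3 omega) & Sp_irreducible omega (calT4 e)]],
      n = 2%N ->
        [/\ torsion_tensors V = (calT1 omega + calT2 e + calT3 omega)%VS,
            directv (calT1 omega + calT2 e + calT3 omega)
          & [/\ Sp_irreducible omega (calT1 omega), Sp_irreducible omega (calT2 e)
              & Sp_irreducible omega (calT3 omega)]],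
      n = 1%N ->
        torsion_tensors V = calT1 omega /\ Sp_irreducible omega (calT1 omega)
    & [/\ \dim (calT1 omega) = (2 * n)%N,
          (2 <= n)%N -> \dim (calT3 omega) = (2 * n)%N,
          (\dim (calT2 e))%:R = 8 / 3 * (n%:R ^+ 3 - n%:R) :> rat
        & (2 <= n)%N ->
          (\dim (calT4 e))%:R = 2 / 3 * n%:R * (2 * n%:R ^+ 2 - 3 * n%:R - 2) :> rat]].
Proof.
move=> _ n0 dimV symp_e.
split=> [n3|n2|n1|].
- have [-> dirT] := torsion_decomposition symp_e dimV (ltnW n3); split=> //; split.
  + exact: calT1_irreducible symp_e n0.
  + exact: calT2_irreducible symp_e dimV (ltnW n3).
  + exact: calT3_irreducible symp_e (ltnW n3).
  + exact: calT4_irreducible symp_e dimV n3.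
- have lt1n : (1 < n)%N by rewrite n2.
  have [-> dirT] := torsion_decomposition symp_e dimV lt1n.
  have T40 : calT4 e = 0%VS.
    apply/eqP; rewrite -dimv_eq0 -(eqr_nat rat) (dim_calT4_rat symp_e dimV lt1n) n2.
    by apply/eqP; field.
  move: dirT; rewrite directv_addE => /and3P[dirT _ _]; rewrite T40 addv0; split=> //; split.
  + exact: calT1_irreducible symp_e n0.
  + exact: calT2_irreducible symp_e dimV lt1n.
  + exact: calT3_irreducible symp_e lt1n.
- have T1_irr := calT1_irreducible symp_e n0; split=> //; apply/esym/eqP.
  (* For [n = 1] both dimensions equal 2, so the inclusion of T1 is an equality. *)
  rewrite eqEdim dim_torsion_tensors dimV (dim_calT1 symp_e dimV) n1 /= andbT.
  by apply/subvP => T /mem_calT1[antiT _]; apply/mem_torsion_tensors.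
- split; first exact: dim_calT1 symp_e dimV.
  + exact: dim_calT3 symp_e dimV.
  + exact: dim_calT2_rat symp_e dimV.
  + exact: dim_calT4_rat symp_e dimV.
Qed.
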